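(* Let $\mathcal{C}$ be the circle in $\mathbb{C}_p$ with center $a$ and radius $R$. Let $\mathcal{D} = D^{+}(a,R)\setminus\bigcup_{i = 1}^{M}D^{-}(x_{i},r_{i})$, with $r_{i} = R$ for $i=1,\dots,m$ (where $m\ge 1$) and $r_{i} < R$ for $m <i \leq M$. Suppose that $|a - x_{i}|_{p} = R$ for $i \leq m$, the discs $D^{-}(x_{i},r_{i})$ are mutually disjoint and the discs $D^{+}(x_{i},r_{i})$ are mutually disjoint for $i>m$. Let $b$ be a point on $\mathcal{C}$ with $|b - x_{i}|_{p} = R$ for all $i$. Let the $\mathcal{C}_{i}$ be circles having centers $x_{i}$ and radii $r_{i}$. For each $i$, let $b_{i}$ be a point on $\mathcal{C}_{i}$ with the condition, for $1 \leq i \leq m$, that $|b_{i} - x_{j}|_{p} = R$ for any $j$ and $|b_{i} - b_{j}|_{p} = R$ if $i \neq j$. Let $\alpha \in \mathbb{Z}_{\geq 0}$. Let $\bar{x} \in \mathcal{D}$ be such that $$|\bar{x} - b_{i}|_{p} = R \ \text{ for } 1 \leq i \leq m, \qquad\text{and}\qquad |\bar{x} - x_{i}|_{p} > r_{i} \ \text{ for } i > m.$$ Let $r^{*} = \min_{1 \leq i \leq M}|\bar{x} - x_{i}|_{p}$ and $\mathcal{D}^{*} = D^{-}(\bar{x}, r^{*})$. Then, if $z\in\mathcal{D}^{*}$, there are constants $\mu_{0},\mu_{1}, \dotsc, \mu_{M}$, depending only on $\alpha$, $\mathcal{D}^{*}$, the region $\mathcal{D}$ with its choice of boundary circle $\mathcal{C}$,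 and the arcs $\mathcal{A}(a, b)$ and $\mathcal{A}(x_{i}, b_{i})$, so that for every Krasner analytic function $f$ on $\mathcal{D}$, $$f(z) = \mu_{0}\int_{\mathcal{A}(a,b),\Phi_{\alpha}}\frac{f(x)}{x - z}\,dx + \sum_{i =1}^{M}\mu_{i}\int_{\mathcal{A}(x_{i},b_{i}),\Phi_{\alpha}}\frac{f(x)}{x - z}\,dx.$$
   Context: $p$ is an odd prime; $\mathbb{C}_p$ is the completion of an algebraic closure of $\mathbb{Q}_p$, with $|p|_p=1/p$. $D^+(c,r)$ and $D^-(c,r)$ are the closed and open discs with center $c$ and radius $r$. Arc: for $a\ne b$ in $\mathbb{C}_p$ with $R=|a-b|_p$, the arc $\mathcal{A}(a,b)$ is the open disc $\{x : |x-b|_p<R\}$. Path sequence: a function $\varphi$ defined for all integers $k\ge k_0$ (some $k_0\in\mathbb{Z}^+$), with values in $\mathbb{Z}^+$ and strictly increasing. For $f:\mathcal{A}(a,b)\to\mathbb{C}_p$ put $A_{f,\varphi}(k)=p^{-\varphi(k)}\sum_{\zeta}(x-a)f(x)$, where $x=a+(b-a)\zeta$ and $\zeta$ runs through the $p^{\varphi(k)}$-th roots of unity. A non-empty family $\Phi$ of path sequences is interlocked if for all $\varphi_1,\varphi_2\in\Phi$ there are $\varphi_3\in\Phi$ and $k_0$ such that $\varphi_3(k)$, $k\ge k_0$, is a subsequence of both $\varphi_1$ and $\varphi_2$. For interlocked $\Phi$, $\int_{\mathcal{A}(a,b),\Phi}f(x)\,dx=L$ means: for every $\varepsilon>0$ there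 are $\varphi_\varepsilon\in\Phi$ and $K_\varepsilon$ with $|A_{f,\varphi_\varepsilon}(k)-L|_p<\varepsilon$ for all $k>K_\varepsilon$ (such $L$ is unique if it exists). For $\alpha\in\mathbb{Z}$, $\Phi_\alpha$ is the interlocked family $\{\varphi : \varphi(k)=\alpha+\lambda k,\ \lambda=1,2,\dots\}$. A function on $\mathcal{D}$ (a closed disc with finitely many open discs removed) is Krasner analytic if it is the uniform limit on $\mathcal{D}$ of rational functions whose poles are outside $\mathcal{D}$.
   Formalization: The formal theorem additionally assumes |b - b_i| = R for 1 ≤ i ≤ m and |x̄ - b| = R; without the first the constants need not exist (p = 7, x_1 a primitive 6th root of unity, a = 0, b = b_1 = 1, x̄ = 0), and without the second the integral over A(a,b) fails to exist for f = 1. *)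

(* Defs.v *)
From HB Require Import structures.
From mathcomp Require Import all_boot all_order all_algebra.
From mathcomp Require Import boolp classical_sets fsbigop reals.

Set Implicit Arguments.
Unset Strict Implicit.
Unset Printing Implicit Defensive.

Import Order.TTheory GRing.Theory Num.Theory.
Local Open Scope classical_set_scope.
Local Open Scope ring_scope.

Section Cp.
Variables (R : realType) (K : closedFieldType) (abs : K -> R).

(* Q_p, as a subfield of K, is the closure of Q. *)
Definition in_Qp (y : K) : Prop :=
  forall eps : R, 0 < eps -> exists q : rat, abs (y - ratr q) < eps.

Definition algebraic_over_Qp (y : K) : Prop :=
  exists P : {poly K}, [/\ P != 0, forall i : nat, in_Qp P`_i & root P y].

(* [is_Cp p abs] characterises (C_p, |.|_p) up to isometric isomorphism.      *)
(* The elements of the algebraically closed field K that are algebraic over   *)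
(* Q_p form an algebraic closure of Q_p; K is complete and this algebraic     *)
(* closure is dense in K, so K is its completion.                             *)
Record is_Cp (p : nat) : Prop := IsCp {
  Cp_abs_ge0 : forall x : K, 0 <= abs x;
  Cp_abs_eq0 : forall x : K, abs x = 0 <-> x = 0;
  Cp_absM : forall x y : K, abs (x * y) = abs x * abs y;
  Cp_absD : forall x y : K, abs (x + y) <= Num.max (abs x) (abs y);
  Cp_abs_p : abs p%:R = p%:R^-1;
  Cp_complete : forall u : nat -> K,
    (forall eps : R, 0 < eps -> exists N : nat, forall n k : nat,
       (N <= n)%N -> (N <= k)%N -> abs (u n - u k) < eps) ->
    exists l : K, forall eps : R, 0 < eps -> exists N : nat, forall n : nat,
       (N <= n)%N -> abs (u n - l) < eps;
  Cp_dense : forall (x : K) (eps : R), 0 < eps ->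
    exists2 y : K, algebraic_over_Qp y & abs (x - y) < eps
}.

Definition closed_disc (c : K) (r : R) : set K := [set x | abs (x - c) <= r].
Definition open_disc (c : K) (r : R) : set K := [set x | abs (x - c) < r].
Definition circle (c : K) (r : R) : set K := [set x | abs (x - c) = r].

Definition padic_arc (a b : K) : set K := open_disc b (abs (a - b)).

Definition region (M : nat) (a : K) (rad : R)
    (x : 'I_M -> K) (r : 'I_M -> R) : set K :=
  closed_disc a rad `\` \bigcup_i open_disc (x i) (r i).

(* A rational function without poles in D is written P / Q with Q nowhere     *)
(* vanishing on D. Only the restriction of f to D matters.                    *)
Definition krasner_analytic (D : set K) (f : K -> K) : Prop :=
  forall eps : R, 0 < eps -> exists P Q : {poly K},
    (forall x, D x -> ~~ root Q x) /\
    (forall x, D x -> abs (f x - P.[x] / Q.[x]) < eps).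

End Cp.

(* The values of [pval] below [pstart] are irrelevant. *)
Record path_seq := PathSeq {
  pstart : nat;
  pval :> nat -> nat;
  pstart_gt0 : (0 < pstart)%N;
  pval_gt0 : forall k : nat, (pstart <= k)%N -> (0 < pval k)%N;
  pval_incr : forall k l : nat, (pstart <= k)%N -> (k < l)%N ->
    (pval k < pval l)%N
}.

Definition tail_subsequence (phi psi : path_seq) (k0 : nat) : Prop :=
  exists n : nat -> nat,
    (forall k l : nat, (k0 <= k)%N -> (k < l)%N -> (n k < n l)%N) /\
    (forall k : nat, (k0 <= k)%N ->
       (pstart psi <= n k)%N /\ phi k = psi (n k)).

Definition interlocked (Phi : set path_seq) : Prop :=
  Phi !=set0 /\
  forall phi1 phi2 : path_seq, Phi phi1 -> Phi phi2 ->
    exists (phi3 : path_seq) (k0 : nat), [/\ Phi phi3, (pstart phi3 <= k0)%N,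
      tail_subsequence phi3 phi1 k0 & tail_subsequence phi3 phi2 k0].

Definition Phi_ (alpha : int) : set path_seq :=
  [set phi | exists2 lambda : nat, (0 < lambda)%N &
     forall k : nat, (pstart phi <= k)%N ->
       (phi k)%:Z = alpha + lambda%:Z * k%:Z].

Section Integral.
Variables (R : realType) (K : closedFieldType) (abs : K -> R) (p : nat).

Definition arc_average (a b : K) (f : K -> K) (N : nat) : K :=
  (p ^ N)%:R^-1 * \sum_(zeta \in [set zeta : K | zeta ^+ (p ^ N) = 1])
                     (a + (b - a) * zeta - a) * f (a + (b - a) * zeta).

(* "The integral of f over the arc A(a,b) along Phi exists and equals L";     *)
(* meant for interlocked families, for which L is unique.                     *)
Definition arc_integral (a b : K) (Phi : set path_seq) (f : K -> K) (L : K) :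
    Prop :=
  forall eps : R, 0 < eps ->
    exists2 phi : path_seq, Phi phi &
      exists Keps : nat, forall k : nat, (pstart phi <= k)%N -> (Keps < k)%N ->
        abs (arc_average a b f (phi k) - L) < eps.

End Integral.

(* The set-level data on which the constants of the integral formula are      *)
(* allowed to depend: the region with its holes numbered, the outer boundary  *)
(* circle, and the arcs. The numbering of the holes is recorded because the   *)
(* arc A(c,d) as a set does not determine the disc around c of radius |c-d|.  *)
Record contour (K : Type) (M : nat) := Contour {
  contour_region : set K;
  contour_hole : 'I_M -> set K;
  contour_circle : set K;
  contour_outer_arc : set K;
  contour_arc : 'I_M -> set K
}.

Lemma affine_path_gt0 (alpha : int) (l k : nat) :
  (0 < l)%N -> (`|alpha|.+1 <= k)%N -> 0 < alpha + l%:Z * k%:Z.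
Proof.
move=> l0 hk; have h : (`|alpha| < l * k)%N by exact: leq_trans hk (leq_pmull _ l0).
rewrite -PoszM -[_ + _]opprK oppr_gt0 opprD subr_lt0.
by apply: le_lt_trans (_ : `|alpha| < _); rewrite ?ltz_nat // -normrN ler_norm.
Qed.

Definition affine_path (alpha : int) (l : nat) (l0 : (0 < l)%N) : path_seq.
Proof.
apply: (@PathSeq `|alpha|.+1 (fun k => `|(alpha + l%:Z * k%:Z)%R|%N)) => //.
- by move=> k hk; rewrite absz_gt0 gt_eqF // affine_path_gt0.
- move=> k k' hk kk'; rewrite -ltz_nat !gtz0_abs ?affine_path_gt0 //.
    by rewrite ltrD2l -!PoszM ltz_nat ltn_pmul2l.
  exact: leq_trans hk (ltnW kk').
Defined.

Lemma affine_pathE (alpha : int) (l : nat) (l0 : (0 < l)%N) (k : nat) :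
  (`|alpha|.+1 <= k)%N -> (affine_path alpha l0 k)%:Z = alpha + l%:Z * k%:Z.
Proof. by move=> hk; rewrite /= gtz0_abs ?affine_path_gt0. Qed.

Lemma Phi_interlocked (alpha : int) : interlocked (Phi_ alpha).
Proof.
split; first by exists (affine_path alpha (ltn0Sn 0)), 1%N => // k; exact: affine_pathE.
move=> phi1 phi2 [l1 l10 h1] [l2 l20 h2].
have l0 : (0 < l1 * l2)%N by rewrite muln_gt0 l10.
exists (affine_path alpha l0), (`|alpha|.+1 + pstart phi1 + pstart phi2)%N; split.
- by exists (l1 * l2)%N => // k; exact: affine_pathE.
- by rewrite /= -addnA leq_addr.
- exists (fun k => l2 * k)%N; split=> [k k' _ kk'|k hk]; first by rewrite ltn_pmul2l.
  have hs : (pstart phi1 <= l2 * k)%N.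
    apply: leq_trans (leq_pmull _ l20); apply: leq_trans hk.
    by rewrite addnAC leq_addl.
  split=> //; apply/eqP; rewrite -eqz_nat h1 // affine_pathE.
    by rewrite !PoszM mulrA.
  by apply: leq_trans hk; rewrite -addnA leq_addr.
- exists (fun k => l1 * k)%N; split=> [k k' _ kk'|k hk]; first by rewrite ltn_pmul2l.
  have hs : (pstart phi2 <= l1 * k)%N.
    by apply: leq_trans (leq_pmull _ l10); apply: leq_trans hk; rewrite leq_addl.
  split=> //; apply/eqP; rewrite -eqz_nat h2 // affine_pathE.
    by rewrite !PoszM mulrA [_ * l1%:Z]mulrC.
  by apply: leq_trans hk; rewrite -addnA leq_addr.
Qed.

(* Main.v *)
Require Import Defs.
From mathcomp Require Import all_boot all_order all_algebra.
From mathcomp Require Import cyclic separable cyclotomic.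
From mathcomp Require Import boolp classical_sets fsbigop reals.
From mathcomp Require Import ring.

Set Implicit Arguments.
Unset Strict Implicit.
Unset Printing Implicit Defensive.

Import Order.TTheory GRing.Theory Num.Theory.
Local Open Scope classical_set_scope.
Local Open Scope ring_scope.

(* For a rational function, the limit along [Phi_alpha] of the averages over an arc A(a, b) is the
   sum over its poles [s] of the residue at [s] times [hlim (((s - a) / (b - a)) ^+ p ^ alpha)],
   where [hlim T] is the limit of [1 / (1 - T ^+ p ^ n)] as [n] tends to [0] in the profinite
   integers: it is 1 if |T| < 1, 0 if |T| > 1, and depends only on the residue class of [T] if
   |T| = 1, where it is congruent to [1 / (1 - T)]. Hence the formula holds for all [f] as soon as
   it holds for the kernels, which is a linear system for the [mu_i]: the combination must be 1
   at [z] and 0 on each hole. Small holes give a triangular part of the matrix; on the outer circle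
   and the holes of full radius it is congruent to a rescaled Cauchy matrix with nodes of distinct
   residues, hence invertible.

   A uniform estimate on [f] does not obviously control the averages, because of the factor
   [p ^- N]; but it does for functions analytic on the open disc A(a, b), whose expansions have
   bounded coefficients while the average of [zeta ^ j] is 0 or 1. This permits uniform limits. *)

(** * Ultrametric valuation *)

(** The existence of [hlim] rests on the nature of C_p: elements algebraic over Q_p are dense, so
    every unit has a residue fixed by some power of Frobenius, of exponent [p ^ l], and
    [T ^+ (p ^ n)] settles down along multiples of [l]. Since [l] depends on the residue, the limit
    is taken at the profinite 0; as [Phi_alpha] contains every step [lambda], a common multiple of
    the required periods is always available. The averages involve [T ^+ (p ^ alpha)], so the Cauchy
    nodes are [p ^ alpha]-th powers of the points in a common rescaling; Frobenius is additive and
    injective on residues, hence distinct residues stay distinct. The assumptions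
    [abs (b - b_ i) = rad] and [abs (xbar - b) = rad] put the outer arc on the same footing as the
    arcs of the large holes. No residues at multiple poles are computed: a multiple pole is
    perturbed into distinct ones. The constants may depend only on sets; this is possible because
    the matrix entries do not change when a centre or an endpoint moves inside its residue disc. *)

Section Valuation.
Variables (R : realType) (K : closedFieldType) (abs : K -> R) (p : nat).
Variable hK : is_Cp abs p.

Lemma absM x y : abs (x * y) = abs x * abs y. Proof. exact: (Cp_absM hK). Qed.
Lemma abs_ge0 x : 0 <= abs x. Proof. exact: (Cp_abs_ge0 hK). Qed.

Lemma abs_eq0 x : (abs x == 0) = (x == 0).
Proof. by apply/eqP/eqP => /(Cp_abs_eq0 hK). Qed.

Lemma abs0 : abs 0 = 0. Proof. by apply/eqP; rewrite abs_eq0. Qed.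

Lemma abs_gt0 x : (0 < abs x) = (x != 0).
Proof. by rewrite lt_neqAle abs_ge0 andbT eq_sym abs_eq0. Qed.

Lemma abs1 : abs 1 = 1.
Proof.
have h : abs 1 * abs 1 = abs 1 * 1 by rewrite -absM !mulr1.
by apply: (mulfI _ h); rewrite abs_eq0 oner_eq0.
Qed.

Lemma absX x n : abs (x ^+ n) = abs x ^+ n.
Proof. by elim: n => [|n IH]; rewrite ?expr0 ?abs1 // !exprS absM IH. Qed.

Lemma absN x : abs (- x) = abs x.
Proof.
have h : abs (-1) = 1.
  have /eqP : abs (-1) ^+ 2 = 1 by rewrite -absX sqrrN expr1n abs1.
  by rewrite sqrp_eq1 ?abs_ge0 // => /eqP.
by rewrite -mulN1r absM h mul1r.
Qed.

Lemma absB x y : abs (x - y) = abs (y - x).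
Proof. by rewrite -absN opprB. Qed.

Lemma absV x : abs x^-1 = (abs x)^-1.
Proof.
have [->|x0] := eqVneq x 0; first by rewrite invr0 abs0 invr0.
apply: (@mulfI _ (abs x)); first by rewrite abs_eq0.
by rewrite -absM !divff ?abs1 ?abs_eq0.
Qed.

Lemma abs_prod (I : Type) (s : seq I) (P : pred I) (F : I -> K) :
  abs (\prod_(i <- s | P i) F i) = \prod_(i <- s | P i) abs (F i).
Proof. exact: (big_morph abs absM abs1). Qed.

Lemma absD_le x y e : abs x <= e -> abs y <= e -> abs (x + y) <= e.
Proof. by move=> hx hy; apply: le_trans (Cp_absD hK x y) _; rewrite ge_max hx. Qed.

Lemma absB_le x y e : abs x <= e -> abs y <= e -> abs (x - y) <= e.
Proof. by move=> hx hy; apply: absD_le; rewrite ?absN. Qed.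

Lemma absD_lt x y e : abs x < e -> abs y < e -> abs (x + y) < e.
Proof. by move=> hx hy; apply: le_lt_trans (Cp_absD hK x y) _; rewrite gt_max hx. Qed.

Lemma absB_lt x y e : abs x < e -> abs y < e -> abs (x - y) < e.
Proof. by move=> hx hy; apply: absD_lt; rewrite ?absN. Qed.

Lemma dist_le y x z e : abs (x - y) <= e -> abs (y - z) <= e -> abs (x - z) <= e.
Proof. by move=> h1 h2; rewrite -(subrKA y); apply: absD_le. Qed.

Lemma dist_lt y x z e : abs (x - y) < e -> abs (y - z) < e -> abs (x - z) < e.
Proof. by move=> h1 h2; rewrite -(subrKA y); apply: absD_lt. Qed.

Lemma abs_sum_le (I : Type) (s : seq I) (P : pred I) (F : I -> K) e :
  0 <= e -> (forall i, P i -> abs (F i) <= e) ->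
  abs (\sum_(i <- s | P i) F i) <= e.
Proof.
move=> e0 h; elim/big_ind: _ => //; first by rewrite abs0.
by move=> x y; apply: absD_le.
Qed.

Lemma abs_sum_lt (I : Type) (s : seq I) (P : pred I) (F : I -> K) e :
  0 < e -> (forall i, P i -> abs (F i) < e) ->
  abs (\sum_(i <- s | P i) F i) < e.
Proof.
move=> e0 h; elim/big_ind: _ => //; first by rewrite abs0.
by move=> x y; apply: absD_lt.
Qed.

Lemma absDl x y : abs y < abs x -> abs (x + y) = abs x.
Proof.
move=> h; apply/eqP; rewrite eq_le absD_le ?(ltW h) //=.
rewrite leNgt; apply/negP => h2.
have := @absB_lt (x + y) y (abs x) h2 h.
by rewrite addrK ltxx.
Qed.

Lemma absDr x y : abs x < abs y -> abs (x + y) = abs y.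
Proof. by rewrite addrC; exact: absDl. Qed.

Lemma dist_eqr x y z : abs (x - y) < abs (y - z) -> abs (x - z) = abs (y - z).
Proof. by move=> h; rewrite -(subrKA y) absDr. Qed.

Lemma dist_eql x y z : abs (y - z) < abs (x - y) -> abs (x - z) = abs (x - y).
Proof. by move=> h; rewrite -(subrKA y) absDl. Qed.

Lemma absM_lt x y e : abs x <= 1 -> abs y < e -> abs (x * y) < e.
Proof.
move=> hx hy; rewrite absM; apply: le_lt_trans hy.
by rewrite ler_piMl ?abs_ge0.
Qed.

Lemma absM_le1 x y : abs x <= 1 -> abs y <= 1 -> abs (x * y) <= 1.
Proof. by move=> hx hy; rewrite absM mulr_ile1 ?abs_ge0. Qed.

Lemma absX_le1 x n : abs x <= 1 -> abs (x ^+ n) <= 1.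
Proof. by move=> hx; rewrite absX exprn_ile1 ?abs_ge0. Qed.

Lemma abs_nat_le1 n : abs n%:R <= 1.
Proof.
elim: n => [|n IH]; first by rewrite abs0.
by rewrite -addn1 natrD absD_le ?abs1.
Qed.

Lemma abs_int_le1 (n : int) : abs n%:~R <= 1.
Proof. by case: n => n; rewrite ?NegzE ?mulrNz ?absN abs_nat_le1. Qed.

(** * Absolute values of integers, and [p]-th powers modulo the maximal ideal *)

Variable hp : prime p.

Lemma abs_p_lt1 : abs p%:R < 1.
Proof.
by rewrite (Cp_abs_p hK) invf_lt1 ?ltr0n ?prime_gt0 // ltr1n prime_gt1.
Qed.

Lemma abs_p_gt0 : 0 < abs p%:R.
Proof. by rewrite (Cp_abs_p hK) invr_gt0 ltr0n prime_gt0. Qed.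

Lemma abs_nat_dvd n : (p %| n)%N -> abs n%:R <= abs p%:R.
Proof.
move=> /dvdnP [q ->]; rewrite natrM absM ler_piMl ?abs_ge0 //.
exact: abs_nat_le1.
Qed.

(** Bezout writes some [u * n] as 1 plus a multiple of [p]; this product has absolute value 1, and
    both of its factors have absolute value at most 1. *)
Lemma abs_nat_coprime n : ~~ (p %| n)%N -> abs n%:R = 1.
Proof.
move=> hn; have n0 : (0 < n)%N by case: n hn; rewrite ?dvdn0.
have [u v e _] := egcdnP p n0.
have c : gcdn n p = 1%N by apply/eqP; rewrite -/(coprime n p) coprime_sym prime_coprime.
rewrite c in e.
have h1 : abs (u%:R * n%:R) = 1.
  rewrite -natrM e natrD -[RHS]abs1 absDr // abs1 natrM.
  by apply: absM_lt; [exact: abs_nat_le1 | exact: abs_p_lt1].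
apply/eqP; rewrite eq_le abs_nat_le1 /= -h1 absM ler_piMl ?abs_ge0 //.
exact: abs_nat_le1.
Qed.

Lemma abs_nat_gt0 n : (0 < n)%N -> 0 < abs n%:R.
Proof.
move=> n0; have /dvdnP [q e] := pfactor_dvdnn p n.
have hq : ~~ (p %| q)%N.
  apply/negP => /dvdnP [q' e'].
  have : (p ^ (logn p n).+1 %| n)%N by rewrite [X in (_ %| X)%N]e e' -mulnA -expnS dvdn_mull.
  by rewrite pfactor_dvdn // ltnn.
rewrite [X in X%:R]e natrM absM abs_nat_coprime // mul1r natrX absX.
by rewrite exprn_gt0 // abs_p_gt0.
Qed.

Lemma natK_neq0 n : (0 < n)%N -> n%:R != 0 :> K.
Proof. by move=> n0; rewrite -abs_gt0 abs_nat_gt0. Qed.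

(** In the factorisation of [x ^+ p - y ^+ p] by [x - y], replacing [x] by [y] in the cofactor costs
    at most [d] and leaves [p%:R * y ^+ p.-1]; this last term is why [d] must be at least
    [abs p%:R]. *)
Lemma pth_contract x y d : abs x <= 1 -> abs y <= 1 -> abs p%:R <= d ->
  abs (x - y) <= d -> abs (x ^+ p - y ^+ p) <= d * abs (x - y).
Proof.
move=> hx hy hpd hd; rewrite subrXX absM mulrC.
apply: ler_wpM2r; first exact: abs_ge0.
have -> : \sum_(i < p) x ^+ (p.-1 - i) * y ^+ i =
  \sum_(i < p) (x ^+ (p.-1 - i) - y ^+ (p.-1 - i)) * y ^+ i + p%:R * y ^+ p.-1.
  have -> : p%:R * y ^+ p.-1 = \sum_(i < p) y ^+ p.-1.
    by rewrite sumr_const card_ord mulr_natl.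
  rewrite -big_split /=; apply: eq_bigr => i _.
  rewrite mulrBl -exprD subnK ?subrK //.
  by rewrite -ltnS prednK ?prime_gt0.
have d0 : 0 <= d by apply: le_trans hd; exact: abs_ge0.
apply: absD_le.
  apply: abs_sum_le => // i _; rewrite subrXX -mulrA absM.
  rewrite -[leRHS]mulr1; apply: ler_pM; rewrite ?abs_ge0 //.
  apply: absM_le1; last exact: absX_le1.
  apply: abs_sum_le => // j _; apply: absM_le1; exact: absX_le1.
rewrite absM -[leRHS]mulr1; apply: ler_pM; rewrite ?abs_ge0 //.
exact: absX_le1.
Qed.

(** One [d] serves all the steps because the distances never grow beyond it. The geometric decay
    obtained here drives the limits of [p]-power sequences. *)
Lemma pow_contract x y d n : abs x <= 1 -> abs y <= 1 ->
  abs p%:R <= d -> d <= 1 -> abs (x - y) <= d ->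
  abs (x ^+ (p ^ n) - y ^+ (p ^ n)) <= d ^+ n.+1.
Proof.
move=> hx hy hpd d1 hd; have d0 : 0 <= d by apply: le_trans hd; exact: abs_ge0.
elim: n => [|n IH]; first by rewrite expn0 !expr1.
rewrite expnSr !exprM.
have h : abs (x ^+ (p ^ n) - y ^+ (p ^ n)) <= d.
  by apply: le_trans IH _; rewrite exprS ler_piMr // exprn_ile1.
apply: le_trans (pth_contract (absX_le1 _ hx) (absX_le1 _ hy) hpd h) _.
by rewrite [leRHS]exprS ler_wpM2l.
Qed.

Lemma pow_close x y n : abs x <= 1 -> abs y <= 1 -> abs (x - y) < 1 ->
  abs (x ^+ (p ^ n) - y ^+ (p ^ n)) < 1.
Proof.
(* The maximum with [abs p%:R] meets the lower bound on [d] in [pow_contract] and still leaves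
   [d < 1]. *)
move=> hx hy h; set d := Num.max (abs p%:R) (abs (x - y)).
have d1 : d < 1 by rewrite /d gt_max abs_p_lt1.
have d0 : 0 <= d by rewrite /d le_max abs_ge0.
have hd : abs (x - y) <= d by rewrite /d le_max lexx orbT.
apply: le_lt_trans (pow_contract n hx hy _ (ltW d1) hd) _.
  by rewrite /d le_max lexx.
by apply: le_lt_trans (d1); rewrite exprS ler_piMr // exprn_ile1 // ltW.
Qed.

(** The inner binomial coefficients are divisible by [p]; writing [p] as [q.+2] lets the two extreme
    terms be peeled off the sum. *)
Lemma frobD1 x y : abs x <= 1 -> abs y <= 1 ->
  abs ((x + y) ^+ p - (x ^+ p + y ^+ p)) <= abs p%:R.
Proof.
move=> hx hy; rewrite exprDn.
have [q hq] : exists q, p = q.+2.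
  by case: p (prime_gt1 hp) => [|[|q]] // _; exists q.
rewrite hq big_ord_recl big_ord_recr /= -hq.
rewrite bin0 subn0 expr0 mulr1 mulr1n /bump /=.
rewrite (_ : (1 + q.+1)%N = p) // binn subnn expr0 mul1r mulr1n.
rewrite (_ : forall u v w : K, u + (v + w) - (u + w) = v); last by move=> *; ring.
apply: abs_sum_le => [|i _]; first exact: abs_ge0.
rewrite -mulr_natr mulrC absM -[leRHS]mulr1; apply: ler_pM; rewrite ?abs_ge0 //.
  apply: abs_nat_dvd; apply: prime_dvd_bin => //.
  by rewrite add1n /= hq !ltnS; have := ltn_ord i.
by apply: absM_le1; exact: absX_le1.
Qed.

Lemma frobD x y n : abs x <= 1 -> abs y <= 1 ->
  abs ((x + y) ^+ (p ^ n) - (x ^+ (p ^ n) + y ^+ (p ^ n))) < 1.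
Proof.
move=> hx hy; elim: n => [|n IH]; first by rewrite expn0 !expr1 subrr abs0 ltr01.
rewrite expnSr !exprM.
apply: (@dist_lt ((x ^+ (p ^ n) + y ^+ (p ^ n)) ^+ p)).
  rewrite -(expn1 p); apply: pow_close; rewrite ?expn1 //.
    by apply: absX_le1; apply: absD_le.
  by apply: absD_le; exact: absX_le1.
apply: le_lt_trans (frobD1 _ _) abs_p_lt1; exact: absX_le1.
Qed.

Variable hodd : odd p.

(** Oddness of [p] turns [(- y) ^+ (p ^ n)] into [- y ^+ (p ^ n)]. *)
Lemma frobB x y n : abs x <= 1 -> abs y <= 1 ->
  abs ((x - y) ^+ (p ^ n) - (x ^+ (p ^ n) - y ^+ (p ^ n))) < 1.
Proof.
move=> hx hy; have := @frobD x (- y) n hx.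
rewrite absN => /(_ hy).
by rewrite [in X in X -> _]exprNn -signr_odd oddX hodd orbT expr1 mulN1r.
Qed.

(** Injectivity of Frobenius on the residue field: [(x - y) ^+ (p ^ n)] is a unit and differs from
    the difference of the powers by an element of the maximal ideal. *)
Lemma frobB_unit x y n : abs x <= 1 -> abs y <= 1 -> abs (x - y) = 1 ->
  abs (x ^+ (p ^ n) - y ^+ (p ^ n)) = 1.
Proof.
move=> hx hy h; have := frobB n hx hy; rewrite absB => h2.
have := @absDr _ ((x - y) ^+ (p ^ n)) _; rewrite absX h expr1n => /(_ _ h2).
by rewrite subrK.
Qed.

End Valuation.

(** * Convergence along the profinite neighbourhoods of zero *)

(* [ev P]: [P n] holds for all positive [n] close enough to [0] in the profinite integers. *)
Definition ev (P : nat -> Prop) : Prop :=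
  exists2 d : nat, (0 < d)%N & forall n : nat, (0 < n)%N -> (d %| n)%N -> P n.

Lemma evT (P : nat -> Prop) : (forall n, P n) -> ev P.
Proof. by move=> h; exists 1%N. Qed.

Lemma ev_geq k : ev (fun n => (k <= n)%N).
Proof.
by exists k.+1 => // n n0 dn; apply: leq_trans (dvdn_leq n0 dn).
Qed.

Lemma ev_dvd d : (0 < d)%N -> ev (fun n => (d %| n)%N).
Proof. by move=> d0; exists d. Qed.

Lemma evI (P Q : nat -> Prop) : ev P -> ev Q -> ev (fun n => P n /\ Q n).
Proof.
move=> [d d0 hd] [e e0 he]; exists (d * e)%N; first by rewrite muln_gt0 d0.
move=> n n0 hn; split; first by apply: hd => //; apply: dvdn_trans hn; exact: dvdn_mulr.
by apply: he => //; apply: dvdn_trans hn; exact: dvdn_mull.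
Qed.

Lemma evS (P Q : nat -> Prop) : (forall n, P n -> Q n) -> ev P -> ev Q.
Proof. by move=> h [d d0 hd]; exists d => // n n0 dn; apply/h/hd. Qed.

Lemma ev_ex (P : nat -> Prop) : ev P -> exists n, P n.
Proof. by move=> [d d0 hd]; exists d; apply: hd. Qed.

Section Convergence.
Variables (R : realType) (K : closedFieldType) (abs : K -> R) (p : nat).
Variable hK : is_Cp abs p.

Definition conv (u : nat -> K) (l : K) : Prop :=
  forall e, 0 < e -> ev (fun n => abs (u n - l) < e).

Lemma small_eq0 x : (forall e, 0 < e -> abs x < e) -> x = 0.
Proof.
move=> h; apply/eqP; rewrite -(abs_eq0 hK); apply/eqP/le_anti.
rewrite (abs_ge0 hK) andbT; apply/ler_addgt0Pr => e e0.
by rewrite add0r ltW // h.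
Qed.

Lemma conv_unique u l l' : conv u l -> conv u l' -> l = l'.
Proof.
move=> h h'; apply/eqP; rewrite -subr_eq0; apply/eqP/small_eq0 => e e0.
have [n [h1 h2]] := ev_ex (evI (h e e0) (h' e e0)).
by apply: (dist_lt hK _ h2); rewrite (absB hK).
Qed.

Lemma conv_ext u v l : ev (fun n => u n = v n) -> conv u l -> conv v l.
Proof.
by move=> huv h e e0; apply: evS (evI huv (h e e0)) => n [<-].
Qed.

Lemma conv_cst c : conv (fun=> c) c.
Proof. by move=> e e0; apply: evT => n; rewrite subrr (abs0 hK). Qed.

Lemma convD u v l l' : conv u l -> conv v l' -> conv (fun n => u n + v n) (l + l').
Proof.
move=> h h' e e0; apply: evS (evI (h e e0) (h' e e0)) => n [h1 h2].
by rewrite opprD addrACA (absD_lt hK).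
Qed.

Lemma convZ c u l : conv u l -> conv (fun n => c * u n) (c * l).
Proof.
move=> h e e0; have [->|c0] := eqVneq c 0.
  by apply: evT => n; rewrite !mul0r subrr (abs0 hK).
have c1 : 0 < abs c by rewrite (abs_gt0 hK).
apply: evS (h (e / abs c) _) => [n|]; last by rewrite divr_gt0.
by rewrite -mulrBr (absM hK) ltr_pdivlMr // mulrC.
Qed.

Lemma conv_dist_le u l v e : conv u l -> ev (fun n => abs (u n - v) <= e) ->
  abs (l - v) <= e.
Proof.
move=> h hv; apply/ler_addgt0Pr => d d0.
have [n [h1 h2]] := ev_ex (evI (h d d0) hv).
have e0 : 0 <= e := le_trans (abs_ge0 hK _) h2.
apply: (@dist_le _ _ _ _ hK (u n)).
  by rewrite (absB hK); apply: le_trans (ltW h1) _; rewrite lerDr.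
by apply: le_trans h2 _; rewrite lerDl ltW.
Qed.

Lemma conv_dist_lt u l v e : 0 < e -> conv u l ->
  ev (fun n => abs (u n - v) < e) -> abs (l - v) < e.
Proof.
move=> e0 h hv; have [n [h1 h2]] := ev_ex (evI (h e e0) hv).
by apply: (@dist_lt _ _ _ _ hK (u n)) => //; rewrite (absB hK).
Qed.

Lemma inv_nat_small (e : R) : 0 < e -> exists N : nat, forall n, (N <= n)%N ->
  n.+1%:R^-1 < e.
Proof.
move=> e0; exists (Num.truncn e^-1).+1 => n hn.
rewrite invf_plt ?posrE ?ltr0n //.
apply: lt_le_trans (_ : (Num.truncn e^-1).+1%:R <= _).
  by rewrite truncnS_gt.
by rewrite ler_nat; apply: leq_trans hn _.
Qed.

Lemma conv_cauchy u :
  (forall e, 0 < e -> exists c, ev (fun n => abs (u n - c) < e)) ->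
  exists l, conv u l.
Proof.
move=> h.
have hd (k : nat) : exists d : nat, (0 < d)%N /\ forall n n', (0 < n)%N ->
    (0 < n')%N -> (d %| n)%N -> (d %| n')%N -> abs (u n - u n') < k.+1%:R^-1.
  have [|c [d d0 hd]] := h k.+1%:R^-1; first by rewrite invr_gt0 ltr0n.
  exists d; split=> // n n' n0 n'0 dn dn'.
  by apply: (@dist_lt _ _ _ _ hK c); rewrite ?[abs (c - _)](absB hK) hd.
have {hd} [d hd] := choice hd.
(* [D k] is a multiple of each of [d 0], ..., [d k], so [u] along [D] is an ordinary Cauchy
   sequence, and completeness provides the candidate limit. *)
pose D k := (\prod_(i < k.+1) d i)%N.
have D0 k : (0 < D k)%N by rewrite prodn_gt0 // => i; case: (hd i).
have dD k n : (k <= n)%N -> (d k %| D n)%N.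
  move=> kn; have hk : (k < n.+1)%N by [].
  by rewrite /D (bigD1 (Ordinal hk)) //= dvdn_mulr.
have close k n : (0 < n)%N -> (d k %| n)%N -> forall j, (k <= j)%N ->
    abs (u n - u (D j)) < k.+1%:R^-1.
  by move=> n0 dn j kj; apply: (hd k).2 => //; exact: dD.
have [|l hl] := Cp_complete hK (u := fun k => u (D k)).
  move=> e e0; have [N hN] := inv_nat_small e0.
  exists N => n k hn hk; apply: lt_trans (hN N (leqnn _)).
  by apply: close => //; exact: dD.
exists l => e e0; have [N hN] := inv_nat_small e0; have [N' hN'] := hl e e0.
exists (d N); first by case: (hd N).
move=> n n0 dn; apply: (@dist_lt _ _ _ _ hK (u (D (maxn N N')))).
  by apply: lt_trans (hN N (leqnn _)); apply: close => //; rewrite leq_maxl.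
by apply: hN'; rewrite leq_maxr.
Qed.

End Convergence.

(** * Residues and Teichmueller limits *)

Lemma geom_small (R : realType) (d e : R) : 0 <= d -> d < 1 -> 0 < e ->
  exists N : nat, forall n, (N <= n)%N -> d ^+ n < e.
Proof.
move=> d0 d1 e0; have [->|dn0] := eqVneq d 0.
  by exists 1%N => n hn; rewrite expr0n gtn_eqF.
have dp : 0 < d by rewrite lt_neqAle eq_sym dn0.
pose x := d^-1 - 1.
have x0 : 0 < x by rewrite subr_gt0 invf_gt1.
(* Bernoulli's inequality for [d^-1 = 1 + x]. *)
have bern n : 1 + n%:R * x <= (d^-1) ^+ n.
  elim: n => [|n IH]; first by rewrite mul0r addr0 expr0.
  rewrite exprS (_ : d^-1 = 1 + x); last by rewrite /x addrC subrK.
  rewrite (_ : d^-1 = 1 + x) in IH; last by rewrite /x addrC subrK.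
  apply: le_trans (_ : (1 + x) * (1 + n%:R * x) <= _); last first.
    by rewrite ler_pM2l // addr_gt0.
  rewrite -subr_ge0 -natr1 (_ : _ - _ = n%:R * x ^+ 2); last by ring.
  by rewrite mulr_ge0 // exprn_ge0 // ltW.
exists (Num.truncn (e * x)^-1).+1 => n hn.
rewrite -[d]invrK exprVn invf_plt ?posrE ?exprn_gt0 ?invr_gt0 //.
apply: lt_le_trans (bern n); rewrite -[X in X < _]add0r ltrD ?ltr01 //.
rewrite -ltr_pdivrMr // -invfM; apply: lt_le_trans (_ : (Num.truncn (e * x)^-1).+1%:R <= _).
  by rewrite truncnS_gt.
by rewrite ler_nat.
Qed.

Section Residue.
Variables (R : realType) (K : closedFieldType) (abs : K -> R) (p : nat).
Variables (hK : is_Cp abs p) (hp : prime p).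

Lemma abs_int (n : int) : abs n%:~R = abs `|n|%N%:R.
Proof. by case: n => n //; rewrite NegzE mulrNz (absN hK) abszN. Qed.

(** A rational number integral at [p] has its residue in the prime field. After division by the gcd
    the denominator [b1] is prime to [p], and Bezout supplies its inverse [u] modulo [p]. Signs are
    carried separately because this gcd is taken in the natural numbers. *)
Lemma int_div_approx (a b : int) : b != 0 -> abs a%:~R <= abs b%:~R ->
  exists n : int, abs (a%:~R / b%:~R - n%:~R) < 1.
Proof.
move=> b0 hab; pose g := gcdn `|a| `|b|.
have g0 : (0 < g)%N by rewrite gcdn_gt0 !absz_gt0 b0 orbT.
have /dvdnP [a1 ea] : (g %| `|a|)%N := dvdn_gcdl _ _.
have /dvdnP [b1 eb] : (g %| `|b|)%N := dvdn_gcdr _ _.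
have gK : abs g%:R > 0 by apply: (abs_nat_gt0 hK).
have co : coprime a1 b1.
  by rewrite /coprime -(eqn_pmul2r g0) muln_gcdl -ea -eb mul1n.
have hab1 : abs a1%:R <= abs b1%:R.
  move: hab; rewrite !abs_int ea eb !natrM !(absM hK).
  by rewrite ler_pM2r.
have hb1 : ~~ (p %| b1)%N.
  apply/negP => pb; have pa : ~~ (p %| a1)%N.
    apply/negP => pa; have : (p %| gcdn a1 b1)%N by rewrite dvdn_gcd pa.
    by rewrite (eqP co) dvdn1; case: p (prime_gt1 hp) => [|[]].
  move: hab1; rewrite (abs_nat_coprime hK hp pa) leNgt.
  by rewrite (le_lt_trans (abs_nat_dvd hK pb) (abs_p_lt1 hK hp)).
have hpb : ~~ (p %| `|b1%:Z|)%N by [].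
have [u [v euv]] : exists u v : int, u * b1%:Z + v * p%:Z = 1.
  have [u [v e]] := Bezoutz b1%:Z p%:Z; exists u, v; rewrite e.
  by rewrite /gcdz /=; congr Posz; apply/eqP; rewrite -/(coprime b1 p) coprime_sym prime_coprime.
exists (sgz a * sgz b * a1%:Z * u).
have bK : b1%:R != 0 :> K.
  by rewrite (natK_neq0 hK hp) // lt0n; apply: contraNneq hb1 => ->.
have eaz : a%:~R = (sgz a)%:~R * (a1%:R * g%:R) :> K.
  by rewrite [in LHS](intEsg a) intrM ea -natrM.
have ebz : b%:~R = (sgz b)%:~R * (b1%:R * g%:R) :> K.
  by rewrite [in LHS](intEsg b) intrM eb -natrM.
have sb2 : (sgz b)%:~R * (sgz b)%:~R = 1 :> K.
  by rewrite -intrM mulz_sg b0.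
have sb0 : (sgz b)%:~R != 0 :> K.
  by apply: contra_eq_neq sb2 => ->; rewrite mul0r eq_sym oner_eq0.
have sbV : (sgz b)%:~R^-1 = (sgz b)%:~R :> K.
  by apply: (mulfI sb0); rewrite divff.
have euvK : u%:~R * b1%:R + v%:~R * p%:R = 1 :> K.
  by have := congr1 (fun n : int => n%:~R : K) euv; rewrite /= intrD !intrM.
have gN0 : g%:R != 0 :> K by rewrite (natK_neq0 hK hp).
rewrite (_ : _ - _ = (sgz a)%:~R * (sgz b)%:~R * (a1%:R / b1%:R) * v%:~R * p%:R).
  apply: (absM_lt hK); last exact: (abs_p_lt1 hK hp).
  apply: (absM_le1 hK); last exact: (abs_int_le1 hK).
  apply: (absM_le1 hK); first by apply: (absM_le1 hK); exact: (abs_int_le1 hK).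
  by rewrite (absM hK) (absV hK) ler_pdivrMr ?mul1r // (abs_gt0 hK).
rewrite eaz ebz !invfM sbV !intrM /=.
rewrite -[RHS]mulrA (_ : v%:~R * p%:R = 1 - u%:~R * b1%:R).
  by field; rewrite gN0 bK.
by rewrite -[LHS](addKr (u%:~R * b1%:R)) euvK addrC.
Qed.

(** The residue of [y] is a root of a monic polynomial over the prime field: the polynomial of [y]
    is scaled by its largest coefficient, its coefficients are replaced by integers with the same
    residues, and terms are dropped from the top until a unit leads. *)
Lemma alg_relation y : algebraic_over_Qp abs y -> abs y = 1 ->
  exists (e : nat) (c : nat -> int),
    abs (y ^+ e - \sum_(i < e) (c i)%:~R * y ^+ i) < 1.
Proof.
move=> [P [P0 hQ rt]] y1.
have n0 : (0 < size P)%N by rewrite lt0n size_poly_eq0.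
pose i1 := Ordinal n0.
have [i0 hi0] : exists i0 : 'I_(size P), forall i : 'I_(size P), abs P`_i <= abs P`_i0.
  have [i0 _ h] := @Order.TotalTheory.arg_maxP _ _ _ i1 xpredT (fun i : 'I_(size P) => abs P`_i) isT.
  by exists i0 => i; exact: h.
have c0 : 0 < abs P`_i0.
  have h : ((size P).-1 < size P)%N by rewrite prednK.
  apply: lt_le_trans (hi0 (Ordinal h)); rewrite (abs_gt0 hK) /=.
  by rewrite -[_`_ _]/(lead_coef P) lead_coef_eq0.
have /choice [q hq] : forall i, exists q : rat, abs (P`_i - ratr q) < abs P`_i0.
  by move=> i; exact: hQ.
have q0 : abs (ratr (q i0)) = abs P`_i0.
  rewrite -[ratr (q i0)](subKr P`_i0) (absDl hK) // (absN hK); exact: hq.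
have hle (i : 'I_(size P)) : abs (ratr (q i)) <= abs P`_i0.
  rewrite -[ratr (q i)](subKr P`_i) (absB_le hK) // ltW //; exact: hq.
(* Dividing by the rational approximation of the largest coefficient, which has the same absolute
   value, keeps the quotients [ratr (q i) / D] rational, as [int_div_approx] requires. *)
pose D : K := ratr (q i0).
have D0 : D != 0 by rewrite -(abs_gt0 hK) q0.
have hn (i : nat) : exists n : int, (i < size P)%N -> abs (ratr (q i) / D - n%:~R) < 1.
  case: (ltnP i (size P)) => hi; last by exists 0.
  have nz (r : rat) : (denq r)%:~R != 0 :> K.
    by rewrite -(abs_gt0 hK) abs_int (abs_nat_gt0 hK hp) // absz_gt0 denq_neq0.
  have e1 : ratr (q i) / D = (numq (q i) * denq (q i0))%:~R / (denq (q i) * numq (q i0))%:~R.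
    rewrite /D /ratr !intrM invf_div !invfM; ring.
  have d1 : denq (q i) * numq (q i0) != 0.
    rewrite mulf_neq0 ?denq_neq0 //; apply: contra_neq D0 => e.
    by rewrite /D /ratr e mul0r.
  have dK : (denq (q i) * numq (q i0))%:~R != 0 :> K.
    by rewrite -(abs_gt0 hK) abs_int (abs_nat_gt0 hK hp) // absz_gt0.
  have [|n hn] := @int_div_approx (numq (q i) * denq (q i0)) _ d1.
    rewrite -[leLHS]mulr1 -(divff (x := abs (denq (q i) * numq (q i0))%:~R)) ?(abs_eq0 hK) //.
    rewrite mulrCA -(absV hK) -(absM hK) -e1 (absM hK) (absV hK) q0.
    by rewrite ger_pMr ?(abs_gt0 hK) // ler_pdivrMr // mul1r (hle (Ordinal hi)).
  by exists n => _; rewrite e1.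
have {hn} [n hn] := choice hn.
have hPn (i : nat) : (i < size P)%N -> abs (P`_i / D - (n i)%:~R) < 1.
  move=> hi; apply: (dist_lt hK _ (hn i hi)).
  by rewrite -mulrBl (absM hK) (absV hK) ltr_pdivrMr ?q0 // mul1r hq.
have nd : abs (n i0)%:~R = 1.
  rewrite -[(n i0)%:~R](subKr 1) (absDl hK) ?(abs1 hK) // (absN hK).
  by have := hn i0 (ltn_ord i0); rewrite /D divff.
have ns : abs (\sum_(i < size P) (n i)%:~R * y ^+ i) < 1.
  rewrite (_ : \sum_(i < _) _ = \sum_(i < size P) ((n i)%:~R - P`_i / D) * y ^+ i).
    apply: (abs_sum_lt hK) => // i _; rewrite mulrC; apply: (absM_lt hK).
      by rewrite (absX hK) y1 expr1n.
    by rewrite (absB hK) hPn.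
  have h0 : \sum_(i < size P) P`_i / D * y ^+ i = 0.
    transitivity (D^-1 * P.[y]); last by rewrite (rootP rt) mulr0.
    rewrite horner_coef mulr_sumr.
    by apply: eq_bigr => i _; ring.
  by under [RHS]eq_bigr do rewrite mulrBl; rewrite sumrB h0 subr0.
have ex : exists2 i, (i < size P)%N & abs (n i)%:~R = 1 by exists i0.
clear -hK hp y1 ns ex; elim: (size P) ns ex => [|s IH] ns [i hi ni] //.
have := abs_int_le1 hK (n s); rewrite le_eqVlt => /orP [/eqP ns1|ns1].
  have s0 : n s != 0 by apply: contra_eq_neq ns1 => ->; rewrite (abs0 hK) eq_sym oner_eq0.
  have [|w hw] := @int_div_approx 1 (n s) s0.
    by rewrite ns1 (abs1 hK).
  exists s, (fun i => - w * n i).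
  have nK : (n s)%:~R != 0 :> K by rewrite -(abs_gt0 hK) ns1.
  rewrite (_ : _ - _ = w%:~R * (\sum_(i < s.+1) (n i)%:~R * y ^+ i)
     + (n s)%:~R * y ^+ s * (1 / (n s)%:~R - w%:~R)).
    apply: (absD_lt hK); first exact: (absM_lt hK (abs_int_le1 hK _)).
    by apply: (absM_lt hK); rewrite // (absM hK) ns1 (absX hK) y1 expr1n mulr1.
  rewrite big_ord_recr /= mulrDr mulr_sumr -sumrN.
  under eq_bigr do rewrite intrM mulrNz -mulrA mulNr opprK.
  by rewrite addrC -!addrA; congr (_ + _); field.
apply: IH.
  rewrite big_ord_recr /= in ns.
  rewrite -[X in abs X](addrK ((n s)%:~R * y ^+ s)); apply: (absB_lt hK ns).
  by rewrite mulrC (absM_lt hK) // (absX hK) y1 expr1n.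
exists i => //; rewrite ltn_neqAle -ltnS hi andbT.
by apply: contraTneq ns1 => <-; rewrite ni ltxx.
Qed.
Lemma abs_modn_close (n : int) : abs (n%:~R - `|(n %% p)%Z|%N%:R) < 1.
Proof.
have p0 : p%:Z != 0 by rewrite -lt0n prime_gt0.
have -> : `|(n %% p)%Z|%N%:R = (n %% p)%Z%:~R :> K.
  by rewrite -[in RHS](gez0_abs (modz_ge0 n p0)).
rewrite {1}(divz_eq n p) intrD intrM addrK.
by apply: (absM_lt hK (abs_int_le1 hK _)); exact: (abs_p_lt1 hK hp).
Qed.

(* Says that the residue ring generated by [y] is finite. *)
Lemma powers_finite y : algebraic_over_Qp abs y -> abs y = 1 ->
  exists (e : nat) (g : nat -> {ffun 'I_e -> 'I_p}), forall k,
    abs (y ^+ k - \sum_(i < e) (g k i : nat)%:R * y ^+ i) < 1.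
Proof.
move=> ha y1; have [e [c hc]] := alg_relation ha y1; exists e.
have yX k : abs (y ^+ k) <= 1 by rewrite (absX hK) y1 expr1n.
(* [S] collects the elements congruent to an integer combination of the first [e] powers of [y]; the
   relation for [y ^+ e] makes all further powers belong to it. *)
pose S w := exists d : nat -> int, abs (w - \sum_(i < e) (d i)%:~R * y ^+ i) < 1.
have SD w w' : S w -> S w' -> S (w + w').
  move=> [d hd] [d' hd']; exists (fun i => d i + d' i).
  under eq_bigr do rewrite intrD mulrDl.
  by rewrite big_split opprD addrACA (absD_lt hK).
have SZ (n : int) w : S w -> S (n%:~R * w).
  move=> [d hd]; exists (fun i => n * d i).
  under eq_bigr do rewrite intrM -mulrA.
  by rewrite -mulr_sumr -mulrBr (absM_lt hK) // (abs_int_le1 hK).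
have SC w w' : abs (w - w') < 1 -> S w -> S w'.
  move=> h [d hd]; exists d; apply: (dist_lt hK _ hd).
  by rewrite (absB hK).
have S0 : S 0.
  exists (fun=> 0); rewrite big1 ?subrr ?(abs0 hK) // => i _.
  by rewrite mul0r.
have Ssum (F : nat -> int) (G : nat -> K) : (forall i, (i < e)%N -> S (G i)) ->
    S (\sum_(i < e) (F i)%:~R * G i).
  by move=> h; elim/big_ind: _ => // i _; apply: SZ; apply: h.
have Sbase i : (i <= e)%N -> S (y ^+ i).
  rewrite leq_eqVlt => /orP [/eqP -> | hi]; first by exists c.
  exists (fun j => (j == i)%:R); rewrite (bigD1 (Ordinal hi)) //= eqxx mul1r.
  rewrite big1 ?addr0 ?subrr ?(abs0 hK) // => j; rewrite -val_eqE /= => /negPf ->.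
  by rewrite mul0r.
have Sy k : S (y ^+ k).
  elim: k => [|k [d hd]]; first exact: Sbase.
  apply: (SC (\sum_(i < e) (d i)%:~R * y ^+ i.+1)); last first.
    by apply: (Ssum d (fun i => y ^+ i.+1)) => i hi; exact: Sbase.
  have -> : \sum_(i < e) (d i)%:~R * y ^+ i.+1 = y * \sum_(i < e) (d i)%:~R * y ^+ i.
    by rewrite mulr_sumr; apply: eq_bigr => i _; rewrite exprS mulrCA.
  by rewrite (absB hK) exprS -mulrBr (absM_lt hK) ?y1.
suff /choice [g hg] : forall k, exists g : {ffun 'I_e -> 'I_p},
    abs (y ^+ k - \sum_(i < e) (g i : nat)%:R * y ^+ i) < 1 by exists g.
move=> k.
have [d hd] := Sy k.
have hm i : (`|(d i %% p)%Z|%N < p)%N.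
  rewrite -ltz_nat gez0_abs ?modz_ge0 ?ltz_pmod //.
    by rewrite ltz_nat prime_gt0.
  by rewrite -lt0n prime_gt0.
exists [ffun i : 'I_e => Ordinal (hm i)].
apply: (dist_lt hK hd); rewrite -sumrB; apply: (abs_sum_lt hK) => // i _.
by rewrite ffunE /= -mulrBl mulrC (absM_lt hK) // abs_modn_close.
Qed.

Lemma nat_pigeonhole (T : finType) (G : nat -> T) :
  exists k l : nat, (k < l)%N /\ G k = G l.
Proof.
apply: contrapT => h.
have inj : injective (fun i : 'I_#|T|.+1 => G i).
  move=> i j hij; apply: val_inj; case: (ltngtP (val i) (val j)) => // lt.
    by case: h; exists i, j.
  by case: h; exists j, i.
by have := leq_card _ inj; rewrite card_ord ltnn.
Qed.

(** * Residues fixed by a power of Frobenius, and limits of [p]-power sequences *)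

Variable hodd : odd p.

(** By density [t] has the residue of an algebraic [y]. Finiteness makes [y ^+ (p ^ k)] and
    [y ^+ (p ^ l)] congruent for some [k < l], and the [p ^ k]-th power is cancelled because
    Frobenius is injective on residues. *)
Lemma teich_exists t : abs t = 1 ->
  exists2 l : nat, (0 < l)%N & abs (t ^+ (p ^ l) - t) < 1.
Proof.
move=> t1; have [y ha hy] := Cp_dense hK t ltr01.
have y1 : abs y = 1.
  by rewrite -[y](subKr t) (absDl hK) ?(absN hK) t1.
have [e [g hg]] := powers_finite ha y1.
have [k [l [kl hkl]]] := nat_pigeonhole (fun k => g (p ^ k)%N).
exists (l - k)%N; first by rewrite subn_gt0.
have yX j : abs (y ^+ j) <= 1 by rewrite (absX hK) y1 expr1n.
set x := y ^+ (p ^ (l - k)).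
have hxy : abs (x - y) < 1.
  have h1 : abs (x ^+ (p ^ k) - y ^+ (p ^ k)) < 1.
    rewrite /x -exprM -expnD subnK ?(ltnW kl) //.
    by apply: (dist_lt hK (hg _)); rewrite (absB hK) -hkl.
  have h2 : abs ((x - y) ^+ (p ^ k) - (x ^+ (p ^ k) - y ^+ (p ^ k))) < 1.
    by apply: (frobB hK hp hodd); rewrite ?y1 // yX.
  have : abs ((x - y) ^+ (p ^ k)) < 1.
    by rewrite -[X in abs X](subrK (x ^+ (p ^ k) - y ^+ (p ^ k))) (absD_lt hK).
  by rewrite (absX hK) expr_lt1 ?expn_gt0 ?prime_gt0 ?(abs_ge0 hK).
apply: (dist_lt hK (y := y)); last by rewrite (absB hK).
apply: (dist_lt hK (y := x)) => //; apply: (pow_close hK hp); rewrite ?t1 ?y1 //.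
Qed.

Lemma pow_conv0 x y e : abs x <= 1 -> abs y <= 1 -> abs (x - y) < 1 -> 0 < e ->
  ev (fun n => abs (x ^+ (p ^ n) - y ^+ (p ^ n)) < e).
Proof.
move=> hx hy h e0; set d := Num.max (abs p%:R) (abs (x - y)).
have d1 : d < 1 by rewrite /d gt_max (abs_p_lt1 hK).
have d0 : 0 <= d by rewrite /d le_max (abs_ge0 hK).
have [N hN] := geom_small d0 d1 e0.
apply: evS (ev_geq N) => n Nn.
apply: le_lt_trans (pow_contract hK hp n hx hy _ (ltW d1) _) _.
- by rewrite /d le_max lexx.
- by rewrite /d le_max lexx orbT.
- by apply: hN; apply: leqW.
Qed.

Lemma pow_self_close t l n : abs t = 1 -> abs (t ^+ (p ^ l) - t) < 1 ->
  (l %| n)%N -> abs (t ^+ (p ^ n) - t) <= Num.max (abs p%:R) (abs (t ^+ (p ^ l) - t)).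
Proof.
move=> t1; set d := Num.max _ _ => h /dvdnP [k ->] {n}.
have d1 : d < 1 by rewrite /d gt_max (abs_p_lt1 hK).
have d0 : 0 <= d by rewrite /d le_max (abs_ge0 hK).
have tX j : abs (t ^+ j) <= 1 by rewrite (absX hK) t1 expr1n.
elim: k => [|k IH]; first by rewrite mul0n expn0 expr1 subrr (abs0 hK).
rewrite mulSn expnD exprM.
apply: (dist_le hK _ IH).
apply: le_trans (pow_contract hK hp _ (tX _) _ _ (ltW d1) _) _.
- by rewrite t1.
- by rewrite /d le_max lexx.
- by rewrite /d le_max lexx orbT.
- by rewrite exprS ler_piMr // exprn_ile1 // ltW.
Qed.

(** For a multiple [n] of [l] with [l * N <= n], the power [t ^+ (p ^ (n - l * N))] is still close
    to [t], and the remaining [p ^ (l * N)]-th power contracts that distance geometrically. The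
    limit is the Teichmueller representative of [t]. *)
Lemma teich_cauchy t e : abs t = 1 -> 0 < e ->
  exists c, ev (fun n => abs (t ^+ (p ^ n) - t ^+ (p ^ c)) < e).
Proof.
move=> t1 e0; have [l l0 hl] := teich_exists t1.
set d := Num.max (abs p%:R) (abs (t ^+ (p ^ l) - t)).
have d1 : d < 1 by rewrite /d gt_max (abs_p_lt1 hK).
have d0 : 0 <= d by rewrite /d le_max (abs_ge0 hK).
have [N hN] := geom_small d0 d1 e0.
have tX j : abs (t ^+ j) <= 1 by rewrite (absX hK) t1 expr1n.
exists (l * N)%N; apply: evS (evI (ev_dvd l0) (ev_geq (l * N))) => n [ln Nn].
rewrite -{1}(subnK Nn) expnD exprM.
apply: le_lt_trans (pow_contract hK hp _ (tX _) _ _ (ltW d1) _) _.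
- by rewrite t1.
- by rewrite /d le_max lexx.
- by apply: pow_self_close => //; rewrite dvdn_subr // dvdn_mulr.
- by apply: hN; apply: leqW; rewrite leq_pmull.
Qed.

(** For [1 <= abs (1 - T)], the exact average of [zeta / (zeta - T)] over the [p ^ n]-th roots of
    unity, hence the arc average of a simple pole. *)
Definition hseq (T : K) (n : nat) : K := (1 - T ^+ (p ^ n))^-1.

(** The default 0 is reached only where no limit exists; for [1 <= abs (1 - T)] there is one. *)
Definition hlim (T : K) : K := xget 0 [set l | conv abs (hseq T) l].

Lemma one_sub_pow T n : abs T <= 1 -> 1 <= abs (1 - T) -> abs (1 - T ^+ (p ^ n)) = 1.
Proof.
move=> T1 h; rewrite -[X in X - _](expr1n _ (p ^ n)).
apply: (frobB_unit hK) => //; first by rewrite (abs1 hK).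
by apply/le_anti; rewrite h (absB_le hK) // (abs1 hK).
Qed.

(** Both denominators are units, so inversion preserves the distance between them. *)
Lemma hseq_dist T T' n n' : abs T <= 1 -> 1 <= abs (1 - T) ->
  abs T' <= 1 -> 1 <= abs (1 - T') ->
  abs (hseq T n - hseq T' n') = abs (T ^+ (p ^ n) - T' ^+ (p ^ n')).
Proof.
move=> T1 h T1' h'; rewrite /hseq.
have := one_sub_pow n T1 h; have := one_sub_pow n' T1' h'.
move: (T ^+ _) (T' ^+ _) => x y u1 u2.
have n1 : 1 - x != 0 by rewrite -(abs_gt0 hK) u2.
have n2 : 1 - y != 0 by rewrite -(abs_gt0 hK) u1.
rewrite (_ : _ - _ = (x - y) * (1 - x)^-1 * (1 - y)^-1); last by field; rewrite n2 n1.
by rewrite !(absM hK) !(absV hK) u1 u2 invr1 !mulr1.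
Qed.

Lemma hseq0 n : hseq 0 n = 1.
Proof. by rewrite /hseq expr0n gtn_eqF ?expn_gt0 ?prime_gt0 // subr0 invr1. Qed.

Lemma hseq_small T : abs T < 1 -> conv abs (hseq T) 1.
Proof.
move=> T1 e e0.
have h0 : 1 <= abs (1 - 0 : K) by rewrite subr0 (abs1 hK).
have hT : 1 <= abs (1 - T) by rewrite (absDl hK) ?(absN hK) (abs1 hK).
have a0 : abs 0 <= 1 by rewrite (abs0 hK).
have := @pow_conv0 T 0 e (ltW T1) a0; rewrite subr0 => /(_ T1 e0).
by apply: evS => n; rewrite -hseq_dist ?(ltW T1) // hseq0.
Qed.

(** [abs (hseq T n)] is the [p ^ n]-th power of [abs T^-1], which reduces the claim to powers of an
    element of the maximal ideal. *)
Lemma hseq_large T : 1 < abs T -> conv abs (hseq T) 0.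
Proof.
move=> T1 e e0.
have T0 : T != 0 by rewrite -(abs_gt0 hK) (lt_trans ltr01).
have V1 : abs T^-1 < 1 by rewrite (absV hK) invf_lt1 // (lt_trans ltr01).
have a0 : abs 0 <= 1 by rewrite (abs0 hK).
have := @pow_conv0 T^-1 0 e (ltW V1) a0; rewrite subr0 => /(_ V1 e0).
apply: evS => n; rewrite [0 ^+ _]expr0n gtn_eqF ?expn_gt0 ?prime_gt0 // !subr0.
rewrite /hseq exprVn !(absV hK) (absDr hK) ?(absN hK) // (abs1 hK) (absX hK).
by rewrite exprn_egt1 // gtn_eqF // expn_gt0 prime_gt0.
Qed.

Lemma hlimE T l : conv abs (hseq T) l -> hlim T = l.
Proof.
by move=> h; apply: (conv_unique hK _ h); apply: (@xgetPex _ 0 [set l | conv abs (hseq T) l]); exists l.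
Qed.

Lemma hlim_conv T : 1 <= abs (1 - T) -> conv abs (hseq T) (hlim T).
Proof.
move=> h; suff [l hl] : exists l, conv abs (hseq T) l by rewrite (hlimE hl).
have [T1|T1|T1] := ltgtP (abs T) 1.
- by exists 1; exact: hseq_small.
- by exists 0; exact: hseq_large.
- have T1' : abs T <= 1 by rewrite T1.
  apply: (conv_cauchy hK) => e e0; have [c hc] := teich_cauchy T1 e0.
  by exists (hseq T c); apply: evS hc => n; rewrite hseq_dist.
Qed.

Lemma hlim_small T : abs T < 1 -> hlim T = 1.
Proof. by move=> h; apply/hlimE/hseq_small. Qed.

Lemma hlim_large T : 1 < abs T -> hlim T = 0.
Proof. by move=> h; apply/hlimE/hseq_large. Qed.

Lemma hlim_eq T T' : abs T <= 1 -> 1 <= abs (1 - T) -> abs (T - T') < 1 ->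
  hlim T = hlim T'.
Proof.
move=> T1 h hT; apply/esym/hlimE => e e0.
have T1' : abs T' <= 1 by rewrite -[T'](subKr T) (absB_le hK) // ltW.
have h' : 1 <= abs (1 - T').
  rewrite (@dist_eql _ _ _ _ hK 1 T T') //.
  exact: lt_le_trans hT h.
apply: evS (evI (hlim_conv h e0) (pow_conv0 T1 T1' hT e0)) => n [h1 h2].
by apply: (dist_lt hK _ h1); rewrite hseq_dist // (absB hK).
Qed.

(** If [abs T = 1] and [n] is a multiple of the Frobenius period of its residue, [T ^+ (p ^ n)] is
    congruent to [T], while [(1 - T)^-1] is [hseq T 0]. The strict bound survives the limit because
    open discs are closed. *)
Lemma hlim_close T : abs T <= 1 -> 1 <= abs (1 - T) ->
  abs (hlim T - (1 - T)^-1) < 1.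
Proof.
move=> T1 h; have u : abs (1 - T) = 1.
  by apply/le_anti; rewrite h (absB_le hK) // (abs1 hK).
move: (T1); rewrite le_eqVlt => /orP [/eqP T1'|T1']; last first.
  rewrite hlim_small //.
  have n0 : 1 - T != 0 by rewrite -(abs_gt0 hK) u.
  rewrite (_ : _ - _ = - (T * (1 - T)^-1)); last by field.
  by rewrite (absN hK) (absM hK) (absV hK) u invr1 mulr1.
apply: (conv_dist_lt hK ltr01 (hlim_conv h)).
have [l l0 hl] := teich_exists T1'.
apply: evS (ev_dvd l0) => n ln.
rewrite (_ : (1 - T)^-1 = hseq T 0); last by rewrite /hseq expn0 expr1.
rewrite hseq_dist // expn0 expr1.
apply: le_lt_trans (pow_self_close T1' hl ln) _.
by rewrite gt_max (abs_p_lt1 hK).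
Qed.
End Residue.

(** * Averages over roots of unity *)

Section Averages.
Variables (R : realType) (K : closedFieldType) (abs : K -> R) (p : nat).
Variables (hK : is_Cp abs p) (hp : prime p).

Lemma prim_root_exists n : (0 < n)%N -> exists w : K, n.-primitive_root w.
Proof.
move=> n0; pose P : {poly K} := 'X^n - 1.
have [r Dp] := closed_field_poly_normal P.
move: Dp; rewrite /P (monicP _) ?monicXnsubC // scale1r => Dp.
have rn1 : all n.-unity_root r by apply/allP=> z; rewrite -root_prod_XsubC -Dp.
have sz_r : (n <= size r)%N.
  by rewrite -ltnS -(size_prod_XsubC r id) -Dp size_XnsubC.
have ur : uniq r.
  rewrite -separable_prod_XsubC -Dp; apply: separable_Xn_sub_1.
  exact: (natK_neq0 hK hp).
by have /hasP [w _ hw] := has_prim_root n0 rn1 ur sz_r; exists w.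
Qed.

Lemma unity_sumE n (w : K) (F : K -> K) : n.-primitive_root w ->
  \sum_(z \in [set z : K | z ^+ n = 1]) F z = \sum_(i < n) F (w ^+ i).
Proof.
move=> hw; have n0 := prim_order_gt0 hw.
pose r := [seq w ^+ (i : 'I_n) | i <- enum 'I_n].
have ur : uniq r.
  rewrite map_inj_uniq ?enum_uniq // => i j /eqP.
  rewrite (eq_prim_root_expr hw) !modn_small // => /eqP; exact: val_inj.
rewrite (_ : [set z | _] = [set` r]).
  by rewrite -fsbig_seq // big_map big_enum.
apply/seteqP; split => z /=.
  by move=> /(prim_rootP hw) [i ->]; apply: map_f; rewrite mem_enum.
by move=> /mapP [i _ ->]; rewrite exprAC (prim_expr_order hw) expr1n.
Qed.

Lemma sum_root_pow n (w : K) j : n.-primitive_root w ->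
  \sum_(i < n) (w ^+ i) ^+ j = if (n %| j)%N then n%:R else 0.
Proof.
move=> hw; case: ifP => [nj|nj].
  rewrite (eq_bigr (fun=> 1)) ?sumr_const ?card_ord // => i _.
  by rewrite -exprM mulnC exprM (eqP (_ : w ^+ j == 1)) ?expr1n // -(prim_order_dvd hw).
have w1 : w ^+ j - 1 != 0 by rewrite subr_eq0 -(prim_order_dvd hw) nj.
apply: (mulfI w1); rewrite mulr0.
under eq_bigr do rewrite exprAC.
by rewrite -subrX1 exprAC (prim_expr_order hw) expr1n subrr.
Qed.

Lemma avg_poly n (w : K) (F : {poly K}) m : n.-primitive_root w -> (size F <= m)%N ->
  n%:R^-1 * \sum_(i < n) F.[w ^+ i] = \sum_(j < m | (n %| j)%N) F`_j.
Proof.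
move=> hw Fm; have n0 := prim_order_gt0 hw.
under eq_bigr do rewrite (horner_coef_wide _ Fm).
rewrite exchange_big /= mulr_sumr [RHS]big_mkcond; apply: eq_bigr => j _.
rewrite -mulr_sumr (sum_root_pow _ hw); case: ifP => _; last by rewrite !mulr0.
by rewrite mulrCA mulVf ?mulr1 // (natK_neq0 hK hp).
Qed.

(* The Gauss norm of [P] is at most [E]. *)
Definition coef_le (E : R) (P : {poly K}) : Prop := forall i, abs P`_i <= E.

Lemma coef_leM E E' P Q : 0 <= E -> 0 <= E' -> coef_le E P -> coef_le E' Q ->
  coef_le (E * E') (P * Q).
Proof.
move=> E0 E'0 hP hQ i; rewrite coefM; apply: (abs_sum_le hK); first exact: mulr_ge0.
by move=> j _; rewrite (absM hK) ler_pM ?(abs_ge0 hK).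
Qed.

Lemma coef_le_sum E (I : Type) (s : seq I) (F : I -> {poly K}) : 0 <= E ->
  (forall i, coef_le E (F i)) -> coef_le E (\sum_(i <- s) F i).
Proof. by move=> E0 h j; rewrite coef_sum; apply: (abs_sum_le hK) => // i _; exact: h. Qed.

Lemma coef_leZ E E' c P : 0 <= E -> abs c <= E -> coef_le E' P -> coef_le (E * E') (c *: P).
Proof. by move=> E0 hc hP i; rewrite coefZ (absM hK) ler_pM ?(abs_ge0 hK). Qed.

Lemma coef_leX n : coef_le 1 ('X^n : {poly K}).
Proof. by move=> i; rewrite coefXn; case: (_ == _); rewrite ?(abs0 hK) ?(abs1 hK). Qed.

Lemma coef_le_exp P n : coef_le 1 P -> coef_le 1 (P ^+ n).
Proof.
move=> hP; elim: n => [|n IH]; first exact: (coef_leX 0).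
by rewrite exprS -[1]mulr1; apply: coef_leM.
Qed.

Lemma coef_le_comp E P G : 0 <= E -> coef_le E P -> coef_le 1 G -> coef_le E (P \Po G).
Proof.
move=> E0 hP hG; rewrite comp_polyE; apply: coef_le_sum => // i.
by rewrite -[E]mulr1; apply: coef_leZ => //; apply: coef_le_exp.
Qed.

Lemma avg_poly_le n (w : K) (F : {poly K}) E : n.-primitive_root w -> 0 <= E ->
  coef_le E F -> abs (n%:R^-1 * \sum_(i < n) F.[w ^+ i]) <= E.
Proof.
by move=> hw E0 hF; rewrite (avg_poly hw (leqnn _)); apply: (abs_sum_le hK) => // j _; exact: hF.
Qed.

(* Cauchy's estimate on circles of radius [|c| < 1], using roots of unity of order prime to [p]. *)
Lemma cauchy_circle (P : {poly K}) E c j :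
  (forall y, abs y < 1 -> abs P.[y] <= E) -> abs c < 1 -> 0 <= E ->
  abs P`_j * abs c ^+ j <= E.
Proof.
move=> hP hc E0; have [js|js] := ltnP j (size P); last first.
  by rewrite nth_default // (abs0 hK) mul0r.
(* [l] is prime to [p], so that [l%:R^-1] has absolute value 1, and it exceeds [size P]. *)
pose l := (p * size P).+1.
have hl : ~~ (p %| l)%N.
  apply/negP => h; have : (p %| l - p * size P)%N by rewrite dvdn_sub // dvdn_mulr.
  by rewrite /l subSnn dvdn1; case: p (prime_gt1 hp) => [|[]].
have sl : (size P < l)%N by rewrite ltnS leq_pmull ?prime_gt0.
have [w hw] := prim_root_exists (ltn0Sn _ : (0 < l)%N).
have w1 i : abs (w ^+ i) = 1.
  apply/eqP; rewrite -(pexpr_eq1 (ltn0Sn _ : (0 < l)%N)) ?(abs_ge0 hK) //.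
  by rewrite -(absX hK) exprAC (prim_expr_order hw) expr1n (abs1 hK).
(* The shift by [l - j] moves the wanted coefficient to index [l]; the other multiples of [l] carry
   nothing, so the average isolates it. *)
pose F := \poly_(i < size P) (P`_i * c ^+ i) * 'X^(l - j).
have e1 : l%:R^-1 * \sum_(i < l) F.[w ^+ i] = P`_j * c ^+ j.
  have cF i : F`_i = if (i < l - j)%N then 0 else P`_(i - (l - j)) * c ^+ (i - (l - j)).
    rewrite /F coefMXn coef_poly; case: ifP => // _; case: ltnP => // h.
    by rewrite nth_default ?mul0r.
  have sF : (size F <= l + l)%N.
    apply/leq_sizeP => i hi; rewrite cF; case: ifP => // _.
    rewrite nth_default ?mul0r // leq_subRL; last first.
      by apply: leq_trans (leq_subr _ _) _; apply: leq_trans hi; rewrite leq_addl.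
    by apply: leq_trans hi; rewrite leq_add ?leq_subr // ltnW.
  have l2 : (l < l + l)%N by rewrite -addn1 leq_add2l.
  rewrite (avg_poly hw sF) (bigD1 (Ordinal l2)) ?dvdnn //= big1 ?addr0.
    by rewrite cF ltnNge leq_subr /= subKn // ltnW // (ltn_trans js sl).
  move=> i /andP [/dvdnP [[|[|q]] ei]]; rewrite -val_eqE /= ei ?mul1n ?eqxx // => _.
    by rewrite cF mul0n subn_gt0 (ltn_trans js sl).
  have := ltn_ord i; rewrite ei addnn -mul2n ltn_mul2r => /andP [_].
  by rewrite !ltnS ltn0.
rewrite -(absX hK) -(absM hK) -e1 (absM hK) (absV hK) (abs_nat_coprime hK hp hl) invr1 mul1r.
apply: (abs_sum_le hK) => // i _.
rewrite hornerM (absM hK) hornerXn -[leRHS]mulr1 ler_pM ?(abs_ge0 hK) //.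
  have := hP (c * w ^+ i); rewrite (absM hK) w1 mulr1 => /(_ hc).
  rewrite horner_poly horner_coef; congr (abs _ <= _); apply: eq_bigr => k _.
  by rewrite exprMn mulrA.
by rewrite -exprM w1.
Qed.

(** The radius can be brought arbitrarily close to 1: with [c ^+ (k * j) = p%:R], a coefficient
    exceeding [E] would force [abs p%:R <= th ^+ k] with [th < 1], which fails for large [k]. *)
Lemma cauchy_estimate (P : {poly K}) E :
  (forall y, abs y < 1 -> abs P.[y] <= E) -> coef_le E P.
Proof.
move=> hP j; have E0 : 0 <= E by apply: le_trans (hP 0 _); rewrite ?(abs_ge0 hK) // (abs0 hK) ltr01.
rewrite leNgt; apply/negP => lt.
have j0 : (0 < j)%N.
  rewrite lt0n; apply: contraTneq lt => ->.
  by rewrite -horner_coef0 -leNgt hP // (abs0 hK) ltr01.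
have P0 : 0 < abs P`_j by apply: le_lt_trans lt.
pose th := E / abs P`_j.
have th1 : th < 1 by rewrite ltr_pdivrMr // mul1r.
have th0 : 0 <= th by rewrite divr_ge0 // ltW.
have [k0 hk] := geom_small th0 th1 (abs_p_gt0 hK hp).
pose k := k0.+1.
have kj : (0 < k * j)%N by rewrite muln_gt0.
have /(@closed_rootP K) [c hc] : size ('X^(k * j) - p%:R%:P : {poly K}) != 1%N.
  by rewrite size_XnsubC // eqSS -lt0n.
have ec : c ^+ (k * j) = p%:R.
  by apply/eqP; move: hc; rewrite rootE !hornerE subr_eq0.
have c1 : abs c < 1.
  rewrite -(expr_lt1 kj) ?(abs_ge0 hK) // -(absX hK) ec; exact: (abs_p_lt1 hK hp).
have := cauchy_circle j hP c1 E0; rewrite mulrC -ler_pdivlMr // -/th => hth.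
have : abs c ^+ j ^+ k <= th ^+ k by rewrite lerXn2r ?nnegrE ?exprn_ge0 ?(abs_ge0 hK).
rewrite -exprM mulnC -(absX hK) ec => /le_lt_trans /(_ (hk k (leqnSn _))).
by rewrite ltxx.
Qed.

(** * Averages over an arc, and bounds uniform in the level *)

Variable hodd : odd p.

Lemma arc_averageE a b (f : K -> K) N (w : K) : (p ^ N)%N.-primitive_root w ->
  arc_average p a b f N = (b - a) *
    ((p ^ N)%:R^-1 * \sum_(i < p ^ N) w ^+ i * f (a + (b - a) * w ^+ i)).
Proof.
move=> hw; rewrite /arc_average (unity_sumE _ hw) mulrCA; congr (_ * _).
by rewrite mulr_sumr; apply: eq_bigr => i _; rewrite addrAC subrr add0r mulrA.
Qed.

(** The [p ^ N]-th power of [w ^+ i - 1] is congruent to [w ^+ i ^+ (p ^ N) - 1 = 0]. For this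
    reason the sample points of an average lie in the open disc called the arc. *)
Lemma unity_close N (w : K) i : (p ^ N)%N.-primitive_root w -> abs (w ^+ i - 1) < 1.
Proof.
move=> hw; have w1 : w ^+ i ^+ (p ^ N) = 1 by rewrite exprAC (prim_expr_order hw) expr1n.
have aw : abs (w ^+ i) <= 1.
  by rewrite -(expr_le1 (prim_order_gt0 hw)) ?(abs_ge0 hK) // -(absX hK) w1 (abs1 hK).
have h1 : abs 1 <= 1 by rewrite (abs1 hK).
have := frobB hK hp hodd N aw h1; rewrite w1 expr1n subrr subr0 (absX hK).
by rewrite expr_lt1 ?(abs_ge0 hK) ?(prim_order_gt0 hw).
Qed.

Lemma arc_point_in a b N (w : K) i : b != a -> (p ^ N)%N.-primitive_root w ->
  abs (a + (b - a) * w ^+ i - b) < abs (b - a).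
Proof.
move=> ba hw; rewrite (_ : _ - b = (b - a) * (w ^+ i - 1)); last by ring.
by rewrite (absM hK) gtr_pMr ?(unity_close _ hw) // (abs_gt0 hK) subr_eq0.
Qed.

(** With [n = p ^ N] and [z ^+ n = 1], the unit [A ^+ n - B ^+ n] equals [A ^+ n - (B * z) ^+ n],
    hence [A - B * z] divides it with an explicit cofactor. The bound 1 does not depend on [N]. *)
Lemma inv_linear_unity N A B : abs A <= 1 -> abs B <= 1 -> abs (A - B) = 1 ->
  exists2 F : {poly K}, coef_le 1 F &
    forall z, z ^+ (p ^ N) = 1 -> (A - B * z)^-1 = F.[z].
Proof.
move=> hA hB hAB; set n := (p ^ N)%N; have n0 : (0 < n)%N by rewrite expn_gt0 prime_gt0.
have u : abs (A ^+ n - B ^+ n) = 1 := frobB_unit hK hp hodd N hA hB hAB.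
have u0 : A ^+ n - B ^+ n != 0 by rewrite -(abs_gt0 hK) u.
exists (\poly_(j < n) ((A ^+ n - B ^+ n)^-1 * (A ^+ (n.-1 - j) * B ^+ j))).
  move=> j; rewrite coef_poly; case: ifP => _; last by rewrite (abs0 hK).
  rewrite (absM hK) (absV hK) u invr1 mul1r.
  by apply: (absM_le1 hK); exact: (absX_le1 hK).
move=> z hz; rewrite horner_poly.
have e : A ^+ n - B ^+ n = (A - B * z) *
    \sum_(j < n) A ^+ (n.-1 - j) * (B * z) ^+ j.
  by rewrite -subrXX exprMn hz mulr1.
under eq_bigr do rewrite -!mulrA -exprMn.
rewrite -mulr_sumr {1}e invfM -mulrA mulVf ?mulr1 //.
by move: u0; rewrite e mulf_eq0 negb_or => /andP [].
Qed.

(** Each factor is [1 / ((1 + 1 / s) - z / s)], whose two coefficients differ by 1. The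
    normalisation by [- s] gives it the value 1 at [z = 1], the centre of the arc in this
    coordinate. *)
Lemma inv_prod_unity N (l : seq K) : (forall s, s \in l -> 1 <= abs s) ->
  exists2 F : {poly K}, coef_le 1 F &
    forall z, z ^+ (p ^ N) = 1 -> \prod_(s <- l) (- s / (z - 1 - s)) = F.[z].
Proof.
elim: l => [|s l IH] hl.
  exists 1 => [|z _]; first exact: (coef_leX 0).
  by rewrite big_nil hornerE.
have [|F F1 hF] := IH; first by move=> t tl; apply: hl; rewrite inE tl orbT.
have s1 : 1 <= abs s by apply: hl; rewrite inE eqxx.
have s0 : s != 0 by rewrite -(abs_gt0 hK) (lt_le_trans ltr01).
have V1 : abs s^-1 <= 1.
  by rewrite (absV hK) invf_le1 // (lt_le_trans ltr01).
have [||| G G1 hG] := @inv_linear_unity N (1 + s^-1) s^-1.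
- by rewrite (absD_le hK) // (abs1 hK).
- exact: V1.
- by rewrite addrK (abs1 hK).
exists (G * F); first by rewrite -[1]mulr1; apply: coef_leM.
move=> z hz; rewrite big_cons hornerM -hF // -hG //; congr (_ * _).
by rewrite -[LHS]invrK invf_div; congr (_^-1); field; rewrite oppr_eq0 s0.
Qed.

(* The averages over roots of unity carry a factor [p ^- N]; they stay bounded because the
   average of [zeta ^ j] is 0 or 1 and [g] expands on the arc with coefficients bounded by [E]. *)
Lemma arc_average_le a b N (P Q : {poly K}) E : b != a ->
  (forall x, abs (x - b) < abs (b - a) -> ~~ root Q x /\ abs (P.[x] / Q.[x]) <= E) ->
  abs (arc_average p a b (fun x => P.[x] / Q.[x]) N) <= abs (b - a) * E.
Proof.
move=> ba h; have ba0 : b - a != 0 by rewrite subr_eq0.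
have r0 : 0 < abs (b - a) by rewrite (abs_gt0 hK).
(* The new coordinate is centred at [b], so the arc becomes the open unit disc and [zeta] becomes
   [zeta - 1]. *)
pose L : {poly K} := (b - a) *: 'X + b%:P.
have hL y : L.[y] = b + (b - a) * y by rewrite !hornerE addrC.
have hy y : abs y < 1 -> abs (L.[y] - b) < abs (b - a).
  by move=> y1; rewrite hL addrAC subrr add0r (absM hK) gtr_pMr.
pose P1 := P \Po L; pose Q1 := Q \Po L.
have [l El] := closed_field_poly_normal Q1.
have Q1y y : abs y < 1 -> Q1.[y] != 0.
  by move=> /hy /h [nr _]; rewrite horner_comp.
have c0 : Q1.[0] != 0 by apply: Q1y; rewrite (abs0 hK) ltr01.
have lc0 : lead_coef Q1 != 0.
  by apply: contraNneq c0 => /eqP; rewrite lead_coef_eq0 => /eqP ->; rewrite horner0.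
have hQ1 y : Q1.[y] = lead_coef Q1 * \prod_(s <- l) (y - s).
  by rewrite {1}El hornerZ horner_prod; congr (_ * _); apply: eq_bigr => s _; rewrite !hornerE.
have hl s : s \in l -> 1 <= abs s.
  move=> sl; rewrite leNgt; apply/negP => /Q1y; rewrite hQ1 (big_rem s) //=.
  by rewrite subrr mul0r mulr0 eqxx.
have s0 s : s \in l -> s != 0 by move=> /hl s1; rewrite -(abs_gt0 hK) (lt_le_trans ltr01).
(* All the roots of [Q1] are outside the open unit disc, so [abs Q1.[y]] is constant there and the
   bound on the quotient becomes a bound on [P1] alone. *)
have absQ y : abs y < 1 -> abs Q1.[y] = abs Q1.[0].
  move=> y1; rewrite !hQ1 !(absM hK) !(abs_prod hK); congr (_ * _).
  rewrite !big_seq; apply: eq_bigr => s /hl s1; rewrite sub0r (absDr hK) // (absN hK).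
  exact: lt_le_trans y1 s1.
have E0 : 0 <= E.
  have [|_] := h b; first by rewrite subrr (abs0 hK).
  exact: le_trans (abs_ge0 hK _).
have P1le : coef_le (E * abs Q1.[0]) P1.
  apply: cauchy_estimate => y y1; rewrite -(absQ _ y1) -ler_pdivrMr ?(abs_gt0 hK) ?Q1y //.
  by rewrite -(absV hK) -(absM hK) !horner_comp; apply: (h _ (hy _ y1)).2.
have [F F1 hF] := inv_prod_unity N hl.
have X1 : coef_le 1 ('X - 1 : {poly K}).
  by move=> i; rewrite coefB (absB_le hK) //; [exact: (coef_leX 1) | exact: (coef_leX 0)].
(* A polynomial that agrees with the summand at the [p ^ N]-th roots of unity, which is all that the
   average sees; its Gauss norm is at most [E] whatever [N] is. *)
pose G := 'X * ((P1 \Po ('X - 1)) * (Q1.[0]^-1 *: F)).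
have GE : coef_le E G.
  have -> : E = 1 * ((E * abs Q1.[0]) * (abs Q1.[0]^-1 * 1)).
    by rewrite mul1r mulr1 (absV hK) mulfK // (abs_eq0 hK).
  have e0 : 0 <= E * abs Q1.[0] by rewrite mulr_ge0 ?(abs_ge0 hK).
  have e1 : 0 <= abs Q1.[0]^-1 * 1 by rewrite mulr1 (abs_ge0 hK).
  apply: coef_leM => //; [by rewrite mulr_ge0 | exact: (coef_leX 1) |].
  apply: coef_leM => //; first exact: coef_le_comp.
  by apply: coef_leZ; rewrite ?(abs_ge0 hK).
have n0 : (0 < p ^ N)%N by rewrite expn_gt0 prime_gt0.
have [w hw] := prim_root_exists n0.
rewrite (arc_averageE _ _ _ hw) (absM hK) ler_pM2l //.
rewrite (eq_bigr (fun i : 'I_(p ^ N) => G.[w ^+ i])); first exact: avg_poly_le.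
move=> i _; have w1 : w ^+ i ^+ (p ^ N) = 1.
  by rewrite exprAC (prim_expr_order hw) expr1n.
rewrite !hornerM hornerX horner_comp hornerZ hornerXsubC; congr (_ * _).
have -> : a + (b - a) * w ^+ i = L.[w ^+ i - 1] by rewrite hL; ring.
rewrite horner_comp; congr (_ * _).
rewrite -hF // -[Q.[_]]horner_comp -/Q1 !hQ1 !invfM -mulrA; congr (_ * _).
rewrite -!prodfV -big_split /=.
rewrite !big_seq; apply: eq_bigr => s /s0 sn0.
by rewrite sub0r mulrA mulVf ?mul1r // oppr_eq0.
Qed.
End Averages.

(** * The integral formula for an abstract contour *)

Section ArcIntegral.
Variables (R : realType) (K : closedFieldType) (abs : K -> R) (p : nat).
Variables (hK : is_Cp abs p) (hp : prime p) (hodd : odd p) (alpha : nat).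

Definition in_arc (a b y : K) : Prop := abs (y - b) < abs (b - a).

(** The integral of [1 / (x - s)] over the arc. An average of level [alpha + n] involves the
    [p ^ (alpha + n)]-th power of the ratio, so [alpha] survives the limit in [n] as an inner
    [p ^ alpha]-th power. *)
Definition pole_integral (a b s : K) : K :=
  hlim abs p (((s - a) / (b - a)) ^+ (p ^ alpha)).

(** The path with [lambda = d] runs through [alpha] plus multiples of [d], so the modulus provided
    by [ev] serves as [lambda]. *)
Lemma conv_arc_integral a b f l :
  conv abs (fun n => arc_average p a b f (alpha + n)) l ->
  arc_integral abs p a b (Phi_ alpha%:Z) f l.
Proof.
move=> h e e0; have [d d0 hd] := h e e0.
exists (affine_path alpha%:Z d0).
  by exists d => // k; exact: affine_pathE.
exists 0%N => k hk k0.
have -> : affine_path alpha%:Z d0 k = (alpha + d * k)%N.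
  by apply/eqP; rewrite -eqz_nat affine_pathE // PoszD PoszM.
by apply: hd; rewrite ?dvdn_mulr // muln_gt0 d0.
Qed.

Lemma arc_average_ext (a b : K) (f g : K -> K) N : b != a -> (forall y, in_arc a b y -> f y = g y) ->
  arc_average p a b f N = arc_average p a b g N.
Proof.
move=> ba h; have n0 : (0 < p ^ N)%N by rewrite expn_gt0 prime_gt0.
have [w hw] := prim_root_exists hK hp n0.
rewrite !(arc_averageE _ _ _ hw); congr (_ * (_ * _)); apply: eq_bigr => i _.
by rewrite h //; exact: (arc_point_in hK hp hodd _ ba hw).
Qed.

Lemma arc_average_lin (a b c : K) (f g : K -> K) N :
  arc_average p a b (fun y => c * f y + g y) N =
  c * arc_average p a b f N + arc_average p a b g N.
Proof.
have n0 : (0 < p ^ N)%N by rewrite expn_gt0 prime_gt0.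
have [w hw] := prim_root_exists hK hp n0.
rewrite !(arc_averageE _ _ _ hw).
under eq_bigr do rewrite mulrDr mulrCA.
by rewrite big_split /= -mulr_sumr; ring.
Qed.

Lemma arc_averageZ (a b c : K) (f : K -> K) N :
  arc_average p a b (fun y => c * f y) N = c * arc_average p a b f N.
Proof.
have n0 : (0 < p ^ N)%N by rewrite expn_gt0 prime_gt0.
have [w hw] := prim_root_exists hK hp n0.
rewrite !(arc_averageE _ _ _ hw).
by under eq_bigr do rewrite mulrCA; rewrite -mulr_sumr; ring.
Qed.

(** The denominator [p ^ N] costs a factor unbounded in [N]; the estimate serves for one fixed [N],
    with the accuracy [E] chosen afterwards. *)
Lemma arc_average_crude (a b : K) (f : K -> K) N E : b != a -> 0 <= E ->
  (forall y, in_arc a b y -> abs (f y) <= E) ->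
  abs (arc_average p a b f N) <= abs (b - a) * (E / abs (p ^ N)%:R).
Proof.
move=> ba E0 h; have n0 : (0 < p ^ N)%N by rewrite expn_gt0 prime_gt0.
have [w hw] := prim_root_exists hK hp n0.
have w1 i : abs (w ^+ i) <= 1.
  rewrite -(expr_le1 n0) ?(abs_ge0 hK) // -(absX hK) exprAC.
  by rewrite (prim_expr_order hw) expr1n (abs1 hK).
rewrite (arc_averageE _ _ _ hw) !(absM hK) (absV hK) ler_wpM2l ?(abs_ge0 hK) //.
rewrite mulrC ler_wpM2r ?invr_ge0 ?(abs_ge0 hK) //.
apply: (abs_sum_le hK) => // i _; rewrite (absM hK) -[E]mul1r ler_pM ?(abs_ge0 hK) //.
by apply: h; exact: (arc_point_in hK hp hodd _ ba hw).
Qed.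

Lemma one_sub_pow_ge t n : 1 <= abs (1 - t) -> 1 <= abs (1 - t ^+ (p ^ n)).
Proof.
move=> h; have [t1|t1] := leP (abs t) 1; first by rewrite (one_sub_pow hK hp hodd).
have tn : 1 < abs (t ^+ (p ^ n)).
  by rewrite (absX hK) exprn_egt1 // gtn_eqF // expn_gt0 prime_gt0.
by rewrite (absDr hK) (absN hK) ?(abs1 hK) // ltW.
Qed.

(** With [n = p ^ N] and [x ^+ n = 1], the factor [x - t] divides [1 - t ^+ n = x ^+ n - t ^+ n].
    This writes [x / (x - t)] at the roots of unity as a polynomial whose only nonzero coefficient
    at a multiple of [n] is the one at [n] itself. *)
Lemma arc_average_pole a b s N : b != a -> abs (b - a) <= abs (s - b) ->
  arc_average p a b (fun y => (y - s)^-1) N = hseq p ((s - a) / (b - a)) N.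
Proof.
move=> ba sb; set t := (s - a) / (b - a); set n := (p ^ N)%N.
have ba0 : b - a != 0 by rewrite subr_eq0.
have n0 : (0 < n)%N by rewrite expn_gt0 prime_gt0.
have [w hw] := prim_root_exists hK hp n0.
have t1 : 1 <= abs (1 - t).
  rewrite (_ : 1 - t = (b - s) / (b - a)); last by rewrite /t; field.
  by rewrite (absM hK) (absV hK) ler_pdivlMr ?(abs_gt0 hK) // mul1r (absB hK b s).
have u0 : 1 - t ^+ n != 0.
  by rewrite -(abs_gt0 hK) (lt_le_trans ltr01) // one_sub_pow_ge.
(* The factor [y - a] in the average shifts the indices by one, so the constant coefficient is 0. *)
pose F := (1 - t ^+ n)^-1 *: \poly_(j < n.+1) (if j is j'.+1 then t ^+ (n.-1 - j') else 0).
rewrite (arc_averageE _ _ _ hw) mulrCA mulr_sumr.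
rewrite (eq_bigr (fun i : 'I_n => F.[w ^+ i])); last first.
  move=> i _; have w1 : w ^+ i ^+ n = 1 by rewrite exprAC (prim_expr_order hw) expr1n.
  rewrite hornerZ horner_poly big_ord_recl /= mul0r add0r.
  under eq_bigr do rewrite exprSr mulrA.
  rewrite -mulr_suml; set x := w ^+ i in w1 *.
  have e : 1 - t ^+ n = (x - t) * \sum_(j < n) t ^+ (n.-1 - j) * x ^+ j.
    by rewrite -[X in X - _ = _]w1 -opprB subrXX -mulNr opprB.
  have xt : x - t != 0 by apply: contraNneq u0; rewrite e => ->; rewrite mul0r.
  have sn : \sum_(j < n) t ^+ (n.-1 - j) * x ^+ j != 0.
    by apply: contraNneq u0; rewrite e => ->; rewrite mulr0.
  rewrite e invfM -mulrA [X in _ = _ * X]mulrA mulVf // mul1r.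
  rewrite (_ : a + _ - s = (b - a) * (x - t)); last by rewrite /t; field.
  by rewrite invfM mulrCA [X in _ * X]mulrA divff // mul1r mulrC.
have sF : (size F <= n.+1)%N by apply: leq_trans (size_scale_leq _ _) _; exact: size_poly.
rewrite (avg_poly hK hp hw sF) (bigD1 ord_max) ?dvdnn //= big1 ?addr0.
  rewrite /F coefZ coef_poly ltnSn /hseq -/n.
  by case: (n) n0 => // n' _; rewrite subnn expr0 mulr1.
move=> j /andP [/dvdnP [q ej]]; rewrite -val_eqE /= ej => qn.
have q0 : q = 0%N.
  have := ltn_ord j; rewrite ej ltnS; case: q {ej} qn => [|[|q]] //.
    by rewrite mul1n eqxx.
  by move=> _; rewrite leqNgt -[X in (X < _)%N]mul1n ltn_mul2r n0.
by rewrite q0 mul0n /F coefZ coef_poly /= mulr0.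
Qed.
Lemma conv_arc_pole a b s : b != a -> abs (b - a) <= abs (s - b) ->
  conv abs (fun n => arc_average p a b (fun y => (y - s)^-1) (alpha + n))
    (pole_integral a b s).
Proof.
move=> ba sb; have ba0 : b - a != 0 by rewrite subr_eq0.
have t1 : 1 <= abs (1 - ((s - a) / (b - a)) ^+ (p ^ alpha)).
  apply: one_sub_pow_ge.
  rewrite (_ : 1 - _ = (b - s) / (b - a)); last by field.
  by rewrite (absM hK) (absV hK) ler_pdivlMr ?(abs_gt0 hK) // mul1r (absB hK b s).
apply: conv_ext (hlim_conv hK hp hodd t1); apply: evT => n.
by rewrite arc_average_pole // /hseq expnD exprM.
Qed.

(** Once [p ^ (alpha + n)] exceeds the degree, only the constant coefficient of [F] contributes, and
    it vanishes because of the factor [x - a] in the average. *)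
Lemma conv_arc_poly a b (P : {poly K}) : b != a ->
  conv abs (fun n => arc_average p a b (fun y => P.[y]) (alpha + n)) 0.
Proof.
move=> ba; pose F := 'X * (P \Po ((b - a) *: 'X + a%:P)).
apply: conv_ext (conv_cst hK 0); apply: evS (ev_geq (size F)) => n Fn.
have n0 : (0 < p ^ (alpha + n))%N by rewrite expn_gt0 prime_gt0.
have [w hw] := prim_root_exists hK hp n0.
rewrite (arc_averageE _ _ _ hw).
rewrite (eq_bigr (fun i : 'I_(p ^ (alpha + n)) => F.[w ^+ i])); last first.
  move=> i _; rewrite hornerM hornerX horner_comp !hornerE.
  by rewrite addrC.
rewrite (avg_poly hK hp hw (leqnn _)) big1 ?mulr0 // => j /dvdnP [q ej].
have : (j < p ^ (alpha + n))%N.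
  apply: leq_trans (ltn_ord j) _; apply: leq_trans Fn _.
  by apply: leq_trans (leq_addl alpha n) _; apply/ltnW/ltn_expl/prime_gt1.
rewrite ej; case: q {ej} => [|q]; last by rewrite ltnNge leq_pmull.
by rewrite mul0n /F coefXM.
Qed.

(* Abstract contour: arcs [A i -> B i] inside [D] and away from [z], and weights [v] for which the
   formula holds for the kernels [1 / (y - s)], with [s = z] and with [s] outside [D]. *)
Section Formula.
Variables (T : finType) (A B : T -> K) (D : set K) (z : K) (v : T -> K).
Hypothesis AB : forall i, B i != A i.
Hypothesis arcD : forall i y, in_arc (A i) (B i) y -> D y.
Hypothesis arcz : forall i y, in_arc (A i) (B i) y -> abs (B i - A i) <= abs (y - z).
Hypothesis Dz : D z.
Hypothesis Dbounded : exists C, forall y, D y -> abs y <= C.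
Hypothesis Dsep : forall s, ~ D s -> exists2 d, 0 < d & forall y, D y -> d <= abs (y - s).
Hypothesis vz : \sum_i v i * pole_integral (A i) (B i) z = 1.
Hypothesis vs : forall s, ~ D s -> \sum_i v i * pole_integral (A i) (B i) s = 0.

Let cauchy_avg (f : K -> K) i N := arc_average p (A i) (B i) (fun y => f y / (y - z)) N.

(** Convergence of all the averages is part of the property, which makes it stable under linear
    combinations and suitable for uniform limits. *)
Definition formula_holds (f : K -> K) : Prop := exists I : T -> K,
  (forall i, conv abs (fun n => cauchy_avg f i (alpha + n)) (I i)) /\
  f z = \sum_i v i * I i.

Lemma B_in_arc i : in_arc (A i) (B i) (B i).
Proof. by rewrite /in_arc subrr (abs0 hK) (abs_gt0 hK) subr_eq0. Qed.

Lemma outside_far i s : ~ D s -> abs (B i - A i) <= abs (s - B i).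
Proof. by move=> Ds; rewrite leNgt; apply/negP => h; apply: Ds; exact: (arcD h). Qed.

Lemma arc_neq_z i y : in_arc (A i) (B i) y -> y - z != 0.
Proof.
move=> /arcz h; rewrite -(abs_gt0 hK); apply: lt_le_trans h.
by rewrite (abs_gt0 hK) subr_eq0.
Qed.

Lemma D_neq y s : D y -> ~ D s -> y - s != 0.
Proof. by move=> Dy Ds; rewrite subr_eq0; apply/eqP => ys; apply: Ds; rewrite -ys. Qed.

Lemma formula_ext f g : (forall y, D y -> f y = g y) -> formula_holds f -> formula_holds g.
Proof.
move=> fg [I [cI eI]]; exists I; split=> [i|]; last by rewrite -fg.
apply: conv_ext (cI i); apply: evT => n; apply: arc_average_ext => // y hy.
by rewrite fg //; exact: arcD hy.
Qed.

Lemma formula_lin c f g : formula_holds f -> formula_holds g ->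
  formula_holds (fun y => c * f y + g y).
Proof.
move=> [I [cI eI]] [J [cJ eJ]]; exists (fun i => c * I i + J i); split=> [i|].
  apply: conv_ext (convD hK (convZ hK c (cI i)) (cJ i)); apply: evT => n.
  rewrite /cauchy_avg -arc_average_lin; congr arc_average.
  by apply/funext => y; rewrite mulrDl mulrA.
rewrite eI eJ mulr_sumr -big_split /=; apply: eq_bigr => i _; ring.
Qed.

(** Subtracting the value at [z] makes the quotient by [y - z] a polynomial, whose integrals
    vanish. *)
Lemma formula_poly (P : {poly K}) : formula_holds (fun y => P.[y]).
Proof.
exists (fun i => P.[z] * pole_integral (A i) (B i) z); split=> [i|]; last first.
  under eq_bigr do rewrite mulrCA.
  by rewrite -mulr_sumr vz mulr1.
have [q hq] : exists q, P - P.[z]%:P = q * ('X - z%:P).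
  by apply/factor_theorem; rewrite rootE !hornerE subrr.
have zB : abs (B i - A i) <= abs (z - B i).
  by rewrite (absB hK z); apply: arcz; exact: B_in_arc.
have := convD hK (convZ hK P.[z] (conv_arc_pole (AB i) zB)) (conv_arc_poly q (AB i)).
rewrite addr0; apply: conv_ext; apply: evT => n.
rewrite -arc_average_lin; apply: arc_average_ext => // y /arc_neq_z yz.
have -> : P.[y] = P.[z] + q.[y] * (y - z).
  have := congr1 (fun F => F.[y]) hq; rewrite !hornerE => <-.
  by rewrite addrC subrK.
by rewrite mulrDl mulfK.
Qed.

(** Partial fractions in [s] and [z]: the weights give 1 on the kernel at [z] and 0 on the kernel at
    [s]. *)
Lemma formula_pole s : ~ D s -> formula_holds (fun y => (y - s)^-1).
Proof.
move=> Ds; have zs := D_neq Dz Ds.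
exists (fun i => (z - s)^-1 * (pole_integral (A i) (B i) z - pole_integral (A i) (B i) s)).
split=> [i|]; last first.
  under eq_bigr do rewrite mulrCA mulrBr.
  by rewrite -mulr_sumr sumrB vz vs // subr0 mulr1.
have zB : abs (B i - A i) <= abs (z - B i).
  by rewrite (absB hK z); apply: arcz; exact: B_in_arc.
have := convZ hK (z - s)^-1 (convD hK (convZ hK (-1) (conv_arc_pole (AB i) (outside_far i Ds)))
  (conv_arc_pole (AB i) zB)).
rewrite mulN1r [- _ + _]addrC; apply: conv_ext; apply: evT => n.
rewrite -arc_average_lin -arc_averageZ; apply: arc_average_ext => // y hy.
have yz := arc_neq_z hy; have ys := D_neq (arcD hy) Ds.
by field; rewrite zs ys yz.
Qed.

Let rat (P Q : {poly K}) (y : K) := P.[y] / Q.[y].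

(** Every arc is at least its radius away from [z], and this radius cancels the one in
    [arc_average_le]. *)
Lemma avg_rat_le P Q i N e : (forall y, D y -> ~~ root Q y) ->
  (forall y, D y -> abs (rat P Q y) <= e) -> abs (cauchy_avg (rat P Q) i N) <= e.
Proof.
move=> hQ hP; have r0 : 0 < abs (B i - A i) by rewrite (abs_gt0 hK) subr_eq0.
rewrite -[e](divfK (lt0r_neq0 r0)) mulrC.
rewrite /cauchy_avg (@arc_average_ext _ _ _ (fun y => P.[y] / (Q * ('X - z%:P)).[y])) //.
  apply: (arc_average_le hK hp hodd) => // y hy; have yD := arcD hy; split.
    by rewrite rootM negb_or hQ // root_XsubC -subr_eq0 (arc_neq_z hy).
  rewrite hornerM !hornerE invfM mulrA (absM hK) (absV hK).
  have yz : 0 < abs (y - z) by rewrite (abs_gt0 hK) (arc_neq_z hy).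
  rewrite ler_pM ?invr_ge0 ?(abs_ge0 hK) //; first exact: hP.
  by rewrite lef_pV2 ?posrE // arcz.
by move=> y _; rewrite /rat hornerM !hornerE invfM mulrA.
Qed.

(** The sharp bound is available for rational functions only. For each [N], an auxiliary fraction
    within [e * abs (p ^ N)%:R] of [f] absorbs the loss in the crude bound; the two fractions are
    then compared by the sharp bound. *)
Lemma avg_close f P Q i N e : krasner_analytic abs D f -> (forall y, D y -> ~~ root Q y) ->
  0 < e -> (forall y, D y -> abs (f y - rat P Q y) <= e) ->
  abs (cauchy_avg f i N - cauchy_avg (rat P Q) i N) <= e.
Proof.
move=> hf hQ e0 fPQ; have r0 : 0 < abs (B i - A i) by rewrite (abs_gt0 hK) subr_eq0.
have pN : 0 < abs (p ^ N)%:R by rewrite (abs_nat_gt0 hK hp) // expn_gt0 prime_gt0.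
have [P' [Q' [hQ' fP']]] := hf _ (mulr_gt0 e0 pN).
have pN1 := abs_nat_le1 hK (p ^ N).
have subE (g h : K -> K) : cauchy_avg g i N - cauchy_avg h i N = cauchy_avg (fun y => g y - h y) i N.
  rewrite addrC -mulN1r /cauchy_avg -arc_average_lin; congr arc_average.
  by apply/funext => y; rewrite mulN1r -mulNr -mulrDl addrC.
apply: (@dist_le _ _ _ _ hK (cauchy_avg (rat P' Q') i N)).
  rewrite subE.
  apply: le_trans (arc_average_crude _ (AB i)
    (E := e * abs (p ^ N)%:R / abs (B i - A i)) _ _) _.
  - by rewrite !mulr_ge0 ?invr_ge0 ?(abs_ge0 hK) ?(ltW e0).
  - move=> y hy; rewrite (absM hK) (absV hK).
    have yz : 0 < abs (y - z) by rewrite (abs_gt0 hK) (arc_neq_z hy).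
    rewrite ler_pM ?invr_ge0 ?(abs_ge0 hK) //; first exact/ltW/fP'/(arcD hy).
    by rewrite lef_pV2 ?posrE // arcz.
  - rewrite [leLHS](_ : _ = e) //; field.
    by rewrite (lt0r_neq0 pN) (lt0r_neq0 r0).
rewrite subE /cauchy_avg (@arc_average_ext _ _ _
  (fun y => rat (P' * Q - P * Q') (Q' * Q) y / (y - z))) //.
  apply: avg_rat_le => y yD; first by rewrite rootM negb_or hQ // hQ'.
  rewrite (_ : rat _ _ y = rat P' Q' y - rat P Q y).
    rewrite (absB hK); apply: (@dist_le _ _ _ _ hK (f y)).
      by rewrite (absB hK) fPQ.
    apply: le_trans (ltW (fP' _ yD)) _; rewrite ler_piMr // ltW //.
  have := hQ _ yD; have := hQ' _ yD; rewrite !rootE /rat => q' q.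
  by rewrite !hornerE; field; rewrite q q'.
move=> y hy; have yD := arcD hy; congr (_ / _).
have := hQ _ yD; have := hQ' _ yD; rewrite !rootE /rat => q' q.
by rewrite !hornerE; field; rewrite q q'.
Qed.

Lemma formula_limit f :
  (forall e, 0 < e -> exists P Q : {poly K}, [/\ forall y, D y -> ~~ root Q y,
     formula_holds (rat P Q) & forall y, D y -> abs (f y - rat P Q y) < e]) ->
  formula_holds f.
Proof.
move=> h; have hf : krasner_analytic abs D f.
  by move=> e /h [P [Q [hQ _ hPQ]]]; exists P, Q.
have /choice [I cI] : forall i, exists l, conv abs (fun n => cauchy_avg f i (alpha + n)) l.
  move=> i; apply: (conv_cauchy hK) => e e0; have e20 : 0 < e / 2 by rewrite divr_gt0.
  have [P [Q [hQ [J [cJ _]] hPQ]]] := h _ e20; exists (J i).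
  apply: evS (cJ i _ e0) => n; apply: (dist_lt hK).
  apply: le_lt_trans (avg_close _ _ hf hQ e20 (fun y yD => ltW (hPQ y yD))) _.
  by rewrite ltr_pdivrMr // mulr_natr mulr2n ltrDl.
exists I; split=> //; apply/eqP; rewrite -subr_eq0; apply/eqP/(small_eq0 hK) => e e0.
(* [C] bounds the weights and is at least 1, so an approximation within [e / 2 / C] controls the
   value at [z] and the weighted integrals together. *)
have [C C0 vC] : exists2 C, 1 <= C & forall i, abs (v i) <= C.
  exists (1 + \sum_i abs (v i)) => [|i].
    by rewrite lerDl sumr_ge0 // => i _; exact: (abs_ge0 hK).
  rewrite (bigD1 i) //= addrCA lerDl addr_ge0 // sumr_ge0 // => j _.
  exact: (abs_ge0 hK).
have C1 : 0 < C by apply: lt_le_trans C0.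
have eC : 0 < e / 2 / C by rewrite !divr_gt0.
have [P [Q [hQ [J [cJ eJ]] hPQ]]] := h _ eC.
have le1 : e / 2 / C <= e / 2 by rewrite ler_pdivrMr // ler_peMr // ltW // divr_gt0.
have lt2 : e / 2 < e by rewrite ltr_pdivrMr // mulr_natr mulr2n ltrDl.
apply: le_lt_trans lt2; apply: (@dist_le _ _ _ _ hK (rat P Q z)).
  by apply: le_trans le1; apply/ltW/hPQ.
rewrite eJ -sumrB; apply: (abs_sum_le hK) => [|i _]; first by rewrite ltW // divr_gt0.
rewrite -mulrBr (absM hK).
apply: le_trans (_ : C * (e / 2 / C) <= _); last by rewrite mulrC divfK ?gt_eqF.
rewrite ler_pM ?(abs_ge0 hK) // (absB hK).
apply: (conv_dist_le hK (cI i)); apply: evS (cJ i _ eC) => n hn.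
apply: (dist_le hK _ (ltW hn)).
exact: avg_close hf hQ eC (fun y yD => ltW (hPQ y yD)).
Qed.

(** * Rational functions with poles outside the region *)

Definition linear_prod (l : seq K) : {poly K} := \prod_(s <- l) ('X - s%:P).

Lemma linear_prod_cons s l y : (linear_prod (s :: l)).[y] = (y - s) * (linear_prod l).[y].
Proof. by rewrite /linear_prod big_cons hornerM !hornerE. Qed.

Lemma linear_prod_nonroot l : (forall s, s \in l -> ~ D s) -> forall y, D y -> ~~ root (linear_prod l) y.
Proof.
move=> hl y yD; rewrite root_prod_XsubC; apply/negP => /hl; exact.
Qed.

Lemma poly_bounded (P : {poly K}) : exists2 C, 0 <= C & forall y, D y -> abs P.[y] <= C.
Proof.
have [C hC] := Dbounded.
have C0 : 0 <= C := le_trans (abs_ge0 hK z) (hC z Dz).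
exists (\sum_(i < size P) abs P`_i * C ^+ i) => [|y yD].
  by rewrite sumr_ge0 // => i _; rewrite mulr_ge0 ?(abs_ge0 hK) ?exprn_ge0.
rewrite horner_coef; apply: (abs_sum_le hK) => [|i _].
  by rewrite sumr_ge0 // => i _; rewrite mulr_ge0 ?(abs_ge0 hK) ?exprn_ge0.
rewrite (bigD1 i) //= -[leLHS]addr0 lerD //.
  by rewrite (absM hK) (absX hK) ler_wpM2l ?(abs_ge0 hK) // lerXn2r ?nnegrE ?(abs_ge0 hK) ?hC.
by rewrite sumr_ge0 // => j _; rewrite mulr_ge0 ?(abs_ge0 hK) ?exprn_ge0.
Qed.

Lemma rat_linear_bounded P l : (forall s, s \in l -> ~ D s) ->
  exists2 C, 0 <= C & forall y, D y -> abs (rat P (linear_prod l) y) <= C.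
Proof.
elim: l => [|s l IH] hl.
  have [C C0 hC] := poly_bounded P; exists C => // y yD.
  by rewrite /rat /linear_prod big_nil hornerE invr1 mulr1 hC.
have [|C C0 hC] := IH; first by move=> t tl; apply: hl; rewrite inE tl orbT.
have [|d d0 hd] := @Dsep s; first by apply: hl; rewrite inE eqxx.
exists (C / d) => [|y yD]; first by rewrite divr_ge0 // ltW.
rewrite /rat linear_prod_cons invfM mulrCA mulrC (absM hK) ler_pM ?(abs_ge0 hK) ?hC //.
rewrite (absV hK) lef_pV2 ?posrE ?hd //.
exact: lt_le_trans d0 (hd _ yD).
Qed.

Lemma small_element e : 0 < e -> exists2 c : K, c != 0 & abs c < e.
Proof.
move=> e0; have [N hN] := geom_small (abs_ge0 hK p%:R) (abs_p_lt1 hK hp) e0.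
exists (p%:R ^+ N); last by rewrite (absX hK) hN.
by rewrite expf_neq0 // (natK_neq0 hK hp) ?prime_gt0.
Qed.

(** Induction on the number of linear factors. If the first two roots differ, partial fractions
    leave one factor fewer; if they coincide, one of them is perturbed, so multiplicities among the
    remaining roots never matter. *)
Lemma formula_rat_linear P l : (forall s, s \in l -> ~ D s) ->
  formula_holds (rat P (linear_prod l)).
Proof.
have [n] := ubnP (size l); elim: n P l => // n IH P [|s [|t l]] szl hl.
- apply: formula_ext (formula_poly P) => y _.
  by rewrite /rat /linear_prod big_nil hornerE invr1 mulr1.
- have Ds : ~ D s by apply: hl; rewrite inE eqxx.
  have [q hq] : exists q, P - P.[s]%:P = q * ('X - s%:P).
    by apply/factor_theorem; rewrite rootE !hornerE subrr.
  apply: formula_ext (formula_lin P.[s] (formula_pole Ds) (formula_poly q)) => y yD.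
  have ys := D_neq yD Ds.
  have -> : rat P (linear_prod [:: s]) y = P.[y] / (y - s).
    by rewrite /rat linear_prod_cons /linear_prod big_nil hornerE mulr1.
  have -> : P.[y] = P.[s] + q.[y] * (y - s).
    have := congr1 (fun F => F.[y]) hq; rewrite !hornerE => <-.
    by rewrite addrC subrK.
  by rewrite mulrDl mulfK.
have distinct u v' : u != v' -> ~ D u -> ~ D v' -> formula_holds (rat P (linear_prod [:: u, v' & l])).
  move=> uv Du Dv; have hl' w : w \in l -> ~ D w by move=> wl; apply: hl; rewrite !inE wl !orbT.
  have IHc w : ~ D w -> formula_holds (rat P (linear_prod (w :: l))).
    move=> Dw; apply: IH => [|w']; first by rewrite /= -ltnS.
    by rewrite inE => /orP [/eqP -> // | /hl'].
  apply: formula_ext (formula_lin (u - v')^-1 (IHc _ Du)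
    (formula_lin (- (u - v')^-1) (IHc _ Dv) (formula_poly 0))) => y yD.
  have yu := D_neq yD Du; have yv := D_neq yD Dv.
  have uv0 : u - v' != 0 by rewrite subr_eq0.
  have := linear_prod_nonroot hl' yD; rewrite rootE => l0.
  by rewrite /rat !linear_prod_cons horner0; field; rewrite uv0 yu yv l0.
have Ds : ~ D s by apply: hl; rewrite !inE eqxx.
have Dt : ~ D t by apply: hl; rewrite !inE eqxx orbT.
have [est|] := eqVneq s t; last by move/distinct; exact.
(* A double pole is a uniform limit of pairs of distinct poles. *)
subst t; apply: formula_limit => e e0.
have [C C0 hC] := rat_linear_bounded P hl.
have [d d0 hd] := Dsep Ds.
(* The bound [d] keeps [s + c] outside [D] and as far from each point of [D] as [s] is; the second
   bound makes the error less than [e], with [C + 1] guarding against [C = 0]. *)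
have [|c c0 hc] := @small_element (Num.min d (e * d / (C + 1))).
  by rewrite lt_min d0 !mulr_gt0 ?invr_gt0 // ltr_wpDl.
move: hc; rewrite lt_min => /andP [cd ce].
pose t := s + c.
have yt y : D y -> abs (y - t) = abs (y - s).
  move=> yD; rewrite (_ : y - t = (y - s) - c); last by rewrite /t; ring.
  by apply: (absDl hK); rewrite (absN hK); exact: lt_le_trans cd (hd _ yD).
have Dt' : ~ D t.
  by move=> /[dup] /yt; rewrite subrr (abs0 hK) => e1 /hd; rewrite -e1 leNgt d0.
exists P, (linear_prod [:: s, t & l]); split.
- apply: linear_prod_nonroot => w; rewrite !inE => /or3P [/eqP -> | /eqP -> | wl] //.
  by apply: hl; rewrite !inE wl !orbT.
- apply: distinct => //; rewrite /t -subr_eq0 opprD addrA subrr sub0r oppr_eq0 //.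
move=> y yD; have ys := D_neq yD Ds; have yt0 := D_neq yD Dt'.
have l0 : (linear_prod l).[y] != 0.
  rewrite -rootE; apply: linear_prod_nonroot yD => w wl.
  by apply: hl; rewrite !inE wl !orbT.
rewrite (_ : _ - _ = rat P (linear_prod [:: s, s & l]) y * (- c / (y - t))); last first.
  rewrite /rat !linear_prod_cons.
  have -> : - c = (y - t) - (y - s) by rewrite /t; ring.
  by field; rewrite ys yt0 l0.
rewrite (absM hK) (absM hK (- c)) (absN hK) (absV hK) yt //.
have ds := hd _ yD; have s0 := lt_le_trans d0 ds.
apply: le_lt_trans (_ : C * (abs c / d) < _).
  rewrite ler_pM ?(abs_ge0 hK) ?hC // ?divr_ge0 ?(abs_ge0 hK) ?(ltW s0) //.
  by rewrite ler_wpM2l ?(abs_ge0 hK) // lef_pV2 ?posrE.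
rewrite mulrA ltr_pdivrMr //.
have C1 : 0 < C + 1 by rewrite ltr_wpDl.
apply: le_lt_trans (_ : (C + 1) * abs c < _).
  by rewrite ler_wpM2r ?(abs_ge0 hK) // lerDl.
by rewrite mulrC -ltr_pdivlMr.
Qed.

Lemma formula_krasner f : krasner_analytic abs D f -> formula_holds f.
Proof.
move=> hf; apply: formula_limit => e /hf [P [Q [hQ hPQ]]]; exists P, Q; split=> //.
have [l El] := closed_field_poly_normal Q.
have lc0 : lead_coef Q != 0.
  rewrite lead_coef_eq0; apply/negP => /eqP Q0; have := hQ _ Dz.
  by rewrite Q0 root0.
have hl s : s \in l -> ~ D s.
  move=> sl /hQ; rewrite El rootZ // root_prod_XsubC sl //.
have fl := formula_rat_linear P hl.
apply: formula_ext (formula_lin (lead_coef Q)^-1 fl (formula_poly 0)) => y yD.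
rewrite horner0 addr0 /rat [in RHS]El hornerZ invfM.
by rewrite mulrCA.
Qed.
End Formula.
End ArcIntegral.

(** * The linear system for the constants *)

Section System.
Variables (R : realType) (K : closedFieldType) (abs : K -> R) (p : nat).
Variables (hK : is_Cp abs p) (hp : prime p) (hodd : odd p) (alpha : nat).

Let pint := pole_integral abs p alpha.

(* A Cauchy matrix whose nodes have distinct residues is invertible over the valuation ring; the
   proof interpolates the numerator of [\sum_i v i / (b i - X)] at the nodes [s j]. *)
Lemma cauchy_matrix_unit (I : finType) (A : {pred I}) (b s v : I -> K) (V : R) : 0 < V ->
  (forall i k, i \in A -> k \in A -> i != k -> abs (b i - b k) = 1) ->
  (forall i k, i \in A -> k \in A -> i != k -> abs (s i - s k) = 1) ->
  (forall i k, i \in A -> k \in A -> abs (b i - s k) = 1) ->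
  (forall j, j \in A -> abs (\sum_(i in A) v i / (b i - s j)) < V) ->
  forall i, i \in A -> abs (v i) < V.
Proof.
move=> V0 bb ss bs hV.
have prod1 (P : pred I) (F : I -> K) : (forall i, P i -> abs (F i) = 1) -> abs (\prod_(i | P i) F i) = 1.
  by move=> h; rewrite (abs_prod hK) big1.
(* The numerator: at a node [s j] its value is the given sum up to a unit, and at [b i] it is [v i]
   up to a unit. *)
pose N := \sum_(i in A) v i *: \prod_(k in A | k != i) ((b k)%:P - 'X).
have sprod (F : I -> {poly K}) j : j \in A -> (forall k, size (F k) <= 2)%N ->
    (size (\prod_(k in A | k != j) F k)%R <= #|A|)%N.
  move=> jA hF; set P : pred I := fun k => (k \in A) && (k != j).
  have card : #|A| = #|P|.+1.
    by rewrite (cardD1 j A) jA add1n; congr _.+1; apply: eq_card => k; rewrite !inE andbC.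
  apply: leq_trans (size_prod_leq _ _) _; rewrite leq_subLR card addnS ltnS addnn -mul2n mulnC.
  by rewrite -sum_nat_const; apply: leq_sum => k _; exact: hF.
have s2 (c : K) : (size (c%:P - 'X)%R <= 2)%N by rewrite -opprB size_polyN size_XsubC.
have sN : (size N <= #|A|)%N.
  apply: leq_trans (size_sum _ _ _) _; apply/bigmax_leqP => i iA.
  by apply: leq_trans (size_scale_leq _ _) _; exact: sprod.
have Ns j : j \in A -> N.[s j] = (\prod_(k in A) (b k - s j)) * \sum_(i in A) v i / (b i - s j).
  move=> jA; rewrite /N horner_sum mulr_sumr; apply: eq_bigr => i iA.
  have n0 : b i - s j != 0 by rewrite -(abs_gt0 hK) bs.
  rewrite hornerZ horner_prod [in RHS](bigD1 i) //= mulrCA mulrC [in RHS]mulrAC divff // mul1r mulrC.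
  by congr (_ * _); apply: eq_bigr => k _; rewrite !hornerE.
have NsV j : j \in A -> abs N.[s j] < V.
  by move=> jA; rewrite Ns // (absM hK) prod1 ?mul1r ?hV // => k kA; exact: bs.
(* The Lagrange interpolant. The differences of nodes are units, so its value at each [b i] stays
   below [V]. *)
pose L := \sum_(j in A) N.[s j] *: \prod_(l in A | l != j) ((s j - s l)^-1 *: ('X - (s l)%:P)).
have sL : (size L <= #|A|)%N.
  apply: leq_trans (size_sum _ _ _) _; apply/bigmax_leqP => i iA.
  apply: leq_trans (size_scale_leq _ _) _; apply: sprod => // k.
  by apply: leq_trans (size_scale_leq _ _) _; rewrite size_XsubC.
have Ls j : j \in A -> L.[s j] = N.[s j].
  move=> jA; rewrite /L horner_sum (bigD1 j) //= [X in _ + X]big1 ?addr0 => [|l /andP [lA lj]].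
    rewrite hornerZ horner_prod big1 ?mulr1 // => l /andP [lA lj].
    rewrite !hornerE mulVf // -(abs_gt0 hK) ss // eq_sym //.
  rewrite hornerZ horner_prod (bigD1 j) ?jA 1?eq_sym //=.
  by rewrite hornerZ hornerXsubC subrr mulr0 mul0r mulr0.
have NL : N = L.
  apply/eqP; rewrite -subr_eq0; apply/eqP.
  pose rs := [seq s j | j <- enum A].
  apply: (@roots_geq_poly_eq0 _ _ rs).
  - apply/allP => u /mapP [j]; rewrite mem_enum => jA ->.
    by rewrite rootE !hornerE Ls // subrr.
  - rewrite map_inj_in_uniq ?enum_uniq // => i j; rewrite !mem_enum => iA jA sij.
    apply/eqP; apply/negPn/negP => /(ss _ _ iA jA).
    by rewrite sij subrr (abs0 hK) => /esym/eqP; rewrite oner_eq0.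
  - rewrite size_map -cardE; apply: leq_trans (size_polyD _ _) _.
    by rewrite size_polyN geq_max sN.
move=> i iA; have Nb : N.[b i] = v i * \prod_(k in A | k != i) (b k - b i).
  rewrite /N horner_sum (bigD1 i) //= [X in _ + X]big1 ?addr0 => [|l /andP [lA li]].
    by rewrite hornerZ horner_prod; congr (_ * _); apply: eq_bigr => k _; rewrite !hornerE.
  rewrite hornerZ horner_prod (bigD1 i) ?iA 1?eq_sym //=.
  by rewrite hornerD hornerN hornerC hornerX subrr mul0r mulr0.
have <- : abs N.[b i] = abs (v i).
  by rewrite Nb (absM hK) prod1 ?mulr1 // => k /andP [kA ki]; exact: bb.
rewrite NL horner_sum; apply: (abs_sum_lt hK) => // j jA.
rewrite hornerZ mulrC; apply: (absM_lt hK); last exact: NsV.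
rewrite horner_prod prod1 // => l /andP [lA lj].
by rewrite !hornerE (absM hK) (absV hK) ss 1?eq_sym // bs // invr1 mul1r.
Qed.

Lemma pole_integral_small a b s : abs (s - a) < abs (b - a) -> pint a b s = 1.
Proof.
move=> h; rewrite /pint /pole_integral (hlim_small hK hp) //.
have b0 : 0 < abs (b - a) by apply: le_lt_trans h; exact: (abs_ge0 hK).
rewrite (absX hK) expr_lt1 ?expn_gt0 ?prime_gt0 ?(abs_ge0 hK) //.
by rewrite (absM hK) (absV hK) ltr_pdivrMr // mul1r.
Qed.

Lemma pole_integral_large a b s : b != a -> abs (b - a) < abs (s - a) -> pint a b s = 0.
Proof.
move=> ba h; rewrite /pint /pole_integral (hlim_large hK hp) //.
have b0 : 0 < abs (b - a) by rewrite (abs_gt0 hK) subr_eq0.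
have t1 : 1 < abs ((s - a) / (b - a)).
  by rewrite (absM hK) (absV hK) ltr_pdivlMr // mul1r.
by rewrite (absX hK) exprn_egt1 // gtn_eqF // expn_gt0 prime_gt0.
Qed.

Lemma pole_ratio a b s : b != a -> abs (s - a) <= abs (b - a) -> abs (b - a) <= abs (s - b) ->
  abs ((s - a) / (b - a)) <= 1 /\ 1 <= abs (1 - (s - a) / (b - a)).
Proof.
move=> ba sa sb; have b0 : 0 < abs (b - a) by rewrite (abs_gt0 hK) subr_eq0.
have ba0 : b - a != 0 by rewrite subr_eq0.
split; first by rewrite (absM hK) (absV hK) ler_pdivrMr // mul1r.
rewrite (_ : 1 - _ = (b - s) / (b - a)); last by field.
by rewrite (absM hK) (absV hK) ler_pdivlMr // mul1r (absB hK b s).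
Qed.

(** The ratio [(s - a) / (b - a)] keeps its residue when the three points move within open discs of
    radius [rho]. This rigidity makes the integrals functions of discs and arcs. *)
Lemma pole_integral_eq rho a b s a' b' s' : 0 < rho -> abs (b - a) = rho ->
  abs (s - a) <= rho -> rho <= abs (s - b) ->
  abs (a - a') < rho -> abs (b - b') < rho -> abs (s - s') < rho ->
  pint a b s = pint a' b' s'.
Proof.
move=> r0 ba sa sb aa bb ss.
have ba0 : b - a != 0 by rewrite -(abs_gt0 hK) ba.
have ba1 : b != a by rewrite -subr_eq0.
have [] := @pole_ratio a b s ba1; rewrite ?ba // => t1 t2.
set d1 := (b - b') - (a - a'); set d2 := (s - s') - (a - a').
have hd1 : abs d1 < rho by exact: (absB_lt hK).
have hd2 : abs d2 < rho by exact: (absB_lt hK).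
have ba' : abs (b' - a') = rho.
  have -> : b' - a' = (b - a) - d1 by rewrite /d1; ring.
  by rewrite (absDl hK) ?(absN hK) ba.
have ba0' : b' - a' != 0 by rewrite -(abs_gt0 hK) ba'.
have tt : abs ((s - a) / (b - a) - (s' - a') / (b' - a')) < 1.
  rewrite (_ : _ - _ = (d2 - (s - a) / (b - a) * d1) / (b' - a')).
    rewrite (absM hK) (absV hK) ba' ltr_pdivrMr // mul1r (absB_lt hK) //.
    exact: (absM_lt hK).
  by rewrite /d1 /d2; field; rewrite ba0 ba0'.
have t1' : abs ((s' - a') / (b' - a')) <= 1.
  rewrite -[X in abs X](subKr ((s - a) / (b - a))) (absB_le hK) //; exact: ltW.
apply: (hlim_eq hK hp hodd); first exact: (absX_le1 hK).
  exact: (one_sub_pow_ge hK hp hodd).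
exact: (pow_close hK hp).
Qed.

(** By additivity of Frobenius on residues, [1 - ((s - a) / (b - a)) ^+ (p ^ alpha)] is congruent to
    [(q b - q s) / (q b - q a)], and [hlim_close] gives the inverse. As [c] and [d] can be common to
    all arcs, the integrals become entries of one rescaled Cauchy matrix. *)
Lemma pole_integral_cauchy a b s c d : 0 < abs d -> abs (b - a) = abs d ->
  abs (b - s) = abs d -> abs (a - c) <= abs d ->
  let q u := ((u - c) / d) ^+ (p ^ alpha) in
  [/\ abs (q b - q a) = 1, abs (q b - q s) = 1 &
    abs (pint a b s - (q b - q a) / (q b - q s)) < 1].
Proof.
move=> d0 ba bs ac q; have dn0 : d != 0 by rewrite -(abs_gt0 hK).
have norm1 u : abs u <= abs d -> abs (u / d) <= 1.
  by move=> h; rewrite (absM hK) (absV hK) ler_pdivrMr // mul1r.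
have norm2 u : abs u = abs d -> abs (u / d) = 1.
  by move=> h; rewrite (absM hK) (absV hK) h divff // gt_eqF.
have bc : abs (b - c) <= abs d by apply: (dist_le hK (y := a)); rewrite ?ba.
have sc : abs (s - c) <= abs d by apply: (dist_le hK (y := b)); rewrite // (absB hK) bs.
have sa : abs (s - a) <= abs d by apply: (dist_le hK (y := b)); rewrite ?ba // (absB hK) bs.
have sub u w : (u - c) / d - (w - c) / d = (u - w) / d by rewrite -mulrBl; congr (_ / _); ring.
have u1 : abs (q b - q a) = 1.
  by apply: (frobB_unit hK hp hodd); rewrite ?sub ?norm1 ?norm2.
have u2 : abs (q b - q s) = 1.
  by apply: (frobB_unit hK hp hodd); rewrite ?sub ?norm1 ?norm2.
split=> //.
have ba1 : b != a by rewrite -subr_eq0 -(abs_gt0 hK) ba.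
have ba0 : b - a != 0 by rewrite subr_eq0.
have [] := @pole_ratio a b s ba1; rewrite ?ba ?(absB hK s b) ?bs // => t1 t2.
have c1 := hlim_close hK hp hodd (absX_le1 hK (p ^ alpha) t1) (one_sub_pow_ge hK hp hodd alpha t2).
apply: (dist_lt hK c1).
pose X := ((s - a) / d) ^+ (p ^ alpha); pose Y := ((b - a) / d) ^+ (p ^ alpha).
have hY : abs (Y - (q b - q a)) < 1.
  by rewrite /Y -sub; apply: (frobB hK hp hodd); exact: norm1.
have hX : abs (X - (q s - q a)) < 1.
  by rewrite /X -sub; apply: (frobB hK hp hodd); exact: norm1.
have Y0 : Y != 0 by rewrite expf_neq0 // mulf_neq0 // invr_eq0.
have hYX : abs (Y - X - (q b - q s)) < 1.
  rewrite (_ : _ - _ = (Y - (q b - q a)) - (X - (q s - q a))); last by ring.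
  exact: (absB_lt hK).
have YX1 : abs (Y - X) = 1.
  by rewrite -[Y - X](subrK (q b - q s)) (absDr hK) u2.
have YX0 : Y - X != 0 by rewrite -(abs_gt0 hK) YX1.
have n2 : q b - q s != 0 by rewrite -(abs_gt0 hK) u2.
have -> : ((s - a) / (b - a)) ^+ (p ^ alpha) = X / Y.
  by rewrite -expr_div_n; congr (_ ^+ _); field; rewrite ba0 dn0.
rewrite (_ : _ - _ = ((q b - q s) * (Y - (q b - q a)) - (q b - q a) * (Y - X - (q b - q s)))
   / ((Y - X) * (q b - q s))).
  rewrite (absM hK) (absV hK) (absM hK) YX1 u2 mulr1 invr1 mulr1.
  by apply: (absB_lt hK); apply: (absM_lt hK); rewrite ?u1 ?u2.
move: (q b) (q a) (q s) n2 => B0 A0 S0 n2.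
by field; rewrite n2 YX0 Y0.
Qed.
(** A row vector in the kernel is zero. Rows outside [A] contribute nothing to columns in [A], where
    the Cauchy congruence makes an entry of largest absolute value strictly smaller than itself;
    what is left are unit rows. *)
Lemma system_solvable n (A : {pred 'I_n}) (ctr en pt : 'I_n -> K) (rad : R) j0 : 0 < rad ->
  (forall i, i \in A -> abs (en i - ctr i) = rad) ->
  (forall i j, i \in A -> j \in A -> abs (en i - pt j) = rad) ->
  (forall i j, i \in A -> j \in A -> i != j -> abs (en i - en j) = rad) ->
  (forall i j, i \in A -> j \in A -> i != j -> abs (pt i - pt j) = rad) ->
  (forall i j, i \notin A -> pint (ctr i) (en i) (pt j) = (i == j)%:R) ->
  exists v : 'I_n -> K,
    forall j, \sum_i v i * pint (ctr i) (en i) (pt j) = (j == j0)%:R.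
Proof.
move=> rad0 hec hep hee hpp hA.
pose H : 'M[K]_n := \matrix_(i, j) pint (ctr i) (en i) (pt j).
suff Hu : H \in unitmx.
  exists (fun i => (delta_mx 0 j0 *m invmx H) (0 : 'I_1) i) => j.
  have := congr1 (fun u : 'rV_n => u 0 j) (mulmxKV Hu (delta_mx (0 : 'I_1) j0)).
  rewrite [LHS]mxE [RHS]mxE eqxx /= => <-; apply: eq_bigr => i _.
  by rewrite [H i j]mxE.
rewrite unitmxE unitfE; apply/det0P => -[v v0 vH].
have vHj j : \sum_i v 0 i * pint (ctr i) (en i) (pt j) = 0.
  transitivity ((v *m H) 0 j); last by rewrite vH mxE.
  by rewrite mxE; apply: eq_bigr => i _; rewrite mxE.
have vA : forall i, i \in A -> v 0 i = 0.
  move=> i1 i1A; apply/eqP/negPn/negP => v1.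
  have [i0 i0A hmax] := @Order.TotalTheory.arg_maxP _ _ _ i1 (mem A) (fun i => abs (v 0 i)) i1A.
  have V0 : 0 < abs (v 0 i0).
    by apply: lt_le_trans (hmax _ i1A); rewrite (abs_gt0 hK).
  (* The arc of the largest entry supplies a centre and a scale for all the large arcs. *)
  pose c := ctr i0; pose d := en i0 - c.
  have dE : abs d = rad := hec _ i0A.
  have d0 : 0 < abs d by rewrite dE.
  have cc i : i \in A -> abs (ctr i - c) <= abs d.
    move=> iA; apply: (dist_le hK (y := en i)); first by rewrite (absB hK) hec ?dE.
    apply: (dist_le hK (y := en i0)); last by rewrite hec ?dE.
    have [->|ii] := eqVneq i i0; first by rewrite subrr (abs0 hK) ltW.
    by rewrite hee ?dE.
  have ec i : i \in A -> abs (en i - c) <= abs d.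
    by move=> iA; apply: (dist_le hK (y := ctr i)); rewrite ?cc // hec ?dE.
  have pc i : i \in A -> abs (pt i - c) <= abs d.
    by move=> iA; apply: (dist_le hK (y := en i)); rewrite ?ec // (absB hK) hep ?dE.
  pose q u := ((u - c) / d) ^+ (p ^ alpha).
  have norm u : abs (u - c) <= abs d -> abs ((u - c) / d) <= 1.
    by move=> h; rewrite (absM hK) (absV hK) ler_pdivrMr // mul1r.
  have qq u w : abs (u - c) <= abs d -> abs (w - c) <= abs d -> abs (u - w) = rad -> abs (q u - q w) = 1.
    move=> hu hw huw; apply: (frobB_unit hK hp hodd); rewrite ?norm //.
    rewrite (_ : _ - _ = (u - w) / d).
      by rewrite (absM hK) (absV hK) huw dE divff // gt_eqF.
    by rewrite -mulrBl; congr (_ / _); ring.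
  have main i j : i \in A -> j \in A -> abs (q (en i) - q (ctr i)) = 1 /\
      abs (pint (ctr i) (en i) (pt j) - (q (en i) - q (ctr i)) / (q (en i) - q (pt j))) < 1.
    move=> iA jA; have [] := @pole_integral_cauchy (ctr i) (en i) (pt j) c d d0.
    - by rewrite hec ?dE.
    - by rewrite hep ?dE.
    - exact: cc.
    - by move=> h1 _ h2; split.
  have := @cauchy_matrix_unit _ A (q \o en) (q \o pt)
     (fun i => v 0 i * (q (en i) - q (ctr i))) (abs (v 0 i0)) V0.
  have h1 : forall i k, i \in A -> k \in A -> i != k -> abs ((q \o en) i - (q \o en) k) = 1.
    by move=> i k iA kA ik; apply: qq; rewrite ?ec ?hee.
  have h2 : forall i k, i \in A -> k \in A -> i != k -> abs ((q \o pt) i - (q \o pt) k) = 1.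
    by move=> i k iA kA ik; apply: qq; rewrite ?pc ?hpp.
  have h3 : forall i k, i \in A -> k \in A -> abs ((q \o en) i - (q \o pt) k) = 1.
    by move=> i k iA kA; apply: qq; rewrite ?ec ?pc ?hep.
  move=> /(_ h1 h2 h3) cm.
  have {cm} := cm _ i0 i0A; rewrite (absM hK) (main i0 i0 i0A i0A).1 mulr1 ltxx => cm.
  apply: notF; apply: cm => j jA /=.
  have sA : \sum_(i in A) v 0 i * pint (ctr i) (en i) (pt j) = 0.
    rewrite -[RHS](vHj j) [RHS](bigID (mem A)) /= [X in _ = _ + X]big1 ?addr0 // => i iA.
    rewrite hA // (_ : (i == j) = false) ?mulr0 //.
    by apply: contraNF iA => /eqP ->.
  (* Subtracting the vanishing sum leaves only the errors of the congruence, each less than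
     [abs (v 0 i0)]. *)
  have -> : \sum_(i in A) v 0 i * (q (en i) - q (ctr i)) / (q (en i) - q (pt j)) =
      \sum_(i in A) (v 0 i * (q (en i) - q (ctr i)) / (q (en i) - q (pt j)) -
                     v 0 i * pint (ctr i) (en i) (pt j)).
    by rewrite sumrB sA subr0.
  apply: (abs_sum_lt hK) => // i iA.
  rewrite -mulrA -mulrBr (absM hK).
  apply: le_lt_trans (_ : abs (v 0 i0) * abs (pint (ctr i) (en i) (pt j) -
    (q (en i) - q (ctr i)) / (q (en i) - q (pt j))) < _).
    rewrite (absB hK (_ / _)) ler_wpM2r ?(abs_ge0 hK) //; exact: hmax.
  by rewrite gtr_pMr // (main i j iA jA).2.
case/negP: v0; apply/eqP/rowP => j; rewrite mxE.
have [/vA //|jA] := boolP (j \in A).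
have := vHj j; rewrite (bigD1 j) //= hA // eqxx mulr1 big1 ?addr0 // => i ij.
have [/vA -> |iA] := boolP (i \in A); first by rewrite mul0r.
by rewrite hA // (negPf ij) mulr0.
Qed.
End System.

(** * The contour of the theorem *)

Record contour_data (R : realType) (K : closedFieldType) (abs : K -> R) (M m : nat)
    (a : K) (rad : R) (x : 'I_M -> K) (r : 'I_M -> R) (b : K) (b_ : 'I_M -> K)
    (xbar : K) (rstar : R) : Prop := ContourData {
  cd_rad_gt0 : 0 < rad;
  cd_r_gt0 : forall i, 0 < r i;
  cd_r_big : forall i : 'I_M, (i < m)%N -> r i = rad;
  cd_r_small : forall i : 'I_M, (m <= i)%N -> r i < rad;
  cd_open_disj : trivIset setT (fun i => open_disc abs (x i) (r i));
  cd_closed_disj : trivIset [set i : 'I_M | (m <= i)%N]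
    (fun i => closed_disc abs (x i) (r i));
  cd_b_circle : circle abs a rad b;
  cd_bx : forall i, abs (b - x i) = rad;
  cd_b_circle_ : forall i, circle abs (x i) (r i) (b_ i);
  cd_b_x : forall i j : 'I_M, (i < m)%N -> abs (b_ i - x j) = rad;
  cd_b_b_ : forall i j : 'I_M, (i < m)%N -> i != j -> abs (b_ i - b_ j) = rad;
  cd_bb_ : forall i : 'I_M, (i < m)%N -> abs (b - b_ i) = rad;
  cd_xbar_in : region abs a rad x r xbar;
  cd_xbar_b : abs (xbar - b) = rad;
  cd_xbar_b_ : forall i : 'I_M, (i < m)%N -> abs (xbar - b_ i) = rad;
  cd_xbar_far : forall i : 'I_M, (m <= i)%N -> r i < abs (xbar - x i);
  cd_rstar_ex : exists i, rstar = abs (xbar - x i);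
  cd_rstar_le : forall i, rstar <= abs (xbar - x i)
}.

(** Index [ord0] stands for the outer circle, or for the evaluation point when the columns of the
    system are indexed; the holes take the other indices. *)
Definition with_outer (T : Type) (M : nat) (a : T) (x : 'I_M -> T) (k : 'I_M.+1) : T :=
  oapp x a (unlift ord0 k).

Lemma with_outer0 (T : Type) (M : nat) (a : T) (x : 'I_M -> T) : with_outer a x ord0 = a.
Proof. by rewrite /with_outer unlift_none. Qed.

Lemma with_outerS (T : Type) (M : nat) (a : T) (x : 'I_M -> T) i :
  with_outer a x (lift ord0 i) = x i.
Proof. by rewrite /with_outer liftK. Qed.

Section Contour.
Variables (R : realType) (K : closedFieldType) (abs : K -> R) (p : nat).
Variables (hK : is_Cp abs p) (hp : prime p) (hodd : odd p) (alpha M m : nat).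

Let pint := pole_integral abs p alpha.

Section Geometry.
Variables (a : K) (rad : R) (x : 'I_M -> K) (r : 'I_M -> R) (b : K) (b_ : 'I_M -> K).
Variables (xbar : K) (rstar : R).
Hypothesis cd : contour_data abs m a rad x r b b_ xbar rstar.

Let D := region abs a rad x r.
Let rad0 := cd_rad_gt0 cd.
Let ctr := with_outer a x.
Let en := with_outer b b_.
(** Hole [i] has index [i + 1], since 0 is the outer circle; hence [<=] in place of [<]. *)
Let big_arc : {pred 'I_M.+1} := fun k => (k <= m)%N.

Lemma big_arcS (i : 'I_M) : (lift ord0 i \in big_arc) = (i < m)%N.
Proof. by rewrite unfold_in lift0. Qed.

Lemma r_le_rad i : r i <= rad.
Proof.
by have [im|im] := ltnP i m; [rewrite (cd_r_big cd) | apply/ltW/(cd_r_small cd)].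
Qed.

Lemma b_a : abs (b - a) = rad. Proof. exact: (cd_b_circle cd). Qed.

Lemma b_x_self i : abs (b_ i - x i) = r i. Proof. exact: (cd_b_circle_ cd). Qed.

Lemma x_a i : abs (x i - a) <= rad.
Proof.
apply: (dist_le hK (y := b)); last by rewrite b_a.
by rewrite (absB hK) (cd_bx cd).
Qed.

Lemma xbar_x_le i : abs (xbar - x i) <= rad.
Proof.
apply: (dist_le hK (y := a)); last by rewrite (absB hK) x_a.
by case: (cd_xbar_in cd).
Qed.

Lemma rstar_le_rad : rstar <= rad.
Proof. by have [i ->] := cd_rstar_ex cd; exact: xbar_x_le. Qed.

Lemma hole_sep i j s : i != j -> abs (s - x j) < r j -> r i <= abs (s - x i).
Proof.
move=> ij sj; rewrite leNgt; apply/negP => si; move/eqP: ij; apply.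
by apply: (cd_open_disj cd) => //; exists s.
Qed.

Lemma hole_center i : abs (x i - x i) < r i.
Proof. by rewrite subrr (abs0 hK) (cd_r_gt0 cd). Qed.

Lemma x_x_far i j : i != j -> r i <= abs (x i - x j).
Proof. by move=> ij; rewrite (absB hK); apply: hole_sep ij (hole_center j). Qed.

Lemma x_x_le i j : abs (x i - x j) <= rad.
Proof.
by apply: (dist_le hK (y := a)); rewrite ?x_a // (absB hK) x_a.
Qed.

Lemma x_x_big (i j : 'I_M) : i != j -> ((i < m) || (j < m))%N -> abs (x i - x j) = rad.
Proof.
move=> ij h; apply/le_anti; rewrite x_x_le /=; case/orP: h => h.
  by rewrite -(cd_r_big cd h) x_x_far.
by rewrite -(cd_r_big cd h) (absB hK) x_x_far // eq_sym.
Qed.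

(** Strictness puts the other holes outside the circle of hole [i], where poles have integral 0.
    Between small holes it comes from disjointness of the closed discs, against a large hole from
    the gap between [r i] and [rad]. *)
Lemma small_hole_sep (i j : 'I_M) s : (m <= i)%N -> i != j -> abs (s - x j) < r j -> r i < abs (s - x i).
Proof.
move=> mi ij sj; have [jm|jm] := ltnP j m; last first.
  rewrite ltNge; apply/negP => si; move/eqP: ij; apply.
  by apply: (cd_closed_disj cd) => //; exists s; split=> //=; exact: ltW.
have xx : abs (x j - x i) = rad by rewrite x_x_big // 1?eq_sym // jm.
rewrite (dist_eqr hK (y := x j)) ?xx; first exact: (cd_r_small cd).
by apply: lt_le_trans sj _; exact: r_le_rad.
Qed.

Lemma small_arc_self i y : abs (y - b_ i) < r i -> abs (y - x i) = r i.
Proof. by move=> h; rewrite (dist_eqr hK (y := b_ i)) b_x_self. Qed.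

Lemma en_ctr k : en k != ctr k.
Proof.
rewrite -subr_eq0 -(abs_gt0 hK) /en /ctr; case: (unliftP ord0 k) => [i|] ->.
  by rewrite !with_outerS b_x_self (cd_r_gt0 cd).
by rewrite !with_outer0 b_a.
Qed.

Lemma arc_in_region k y : in_arc abs (ctr k) (en k) y -> D y.
Proof.
rewrite /in_arc /en /ctr; case: (unliftP ord0 k) => [i|] ->; rewrite ?with_outerS ?with_outer0.
  rewrite b_x_self => yi; have yx := small_arc_self yi.
  split=> [|[j _]]; last rewrite /open_disc /= => yj.
    apply: (dist_le hK (y := x i)); last exact: x_a.
    by rewrite yx r_le_rad.
  have [ij|ij] := eqVneq i j; first by move: yj; rewrite -ij yx ltxx.
  have [im|im] := ltnP i m; last by have := small_hole_sep im ij yj; rewrite yx ltxx.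
  have e : abs (y - x j) = rad.
    rewrite (dist_eqr hK (y := b_ i)) (cd_b_x cd) //.
    by move: yi; rewrite (cd_r_big cd im).
  by move: yj; rewrite e ltNge r_le_rad.
rewrite b_a => yb; split=> [|[j _]]; last rewrite /open_disc /= => yj.
  by apply: (dist_le hK (y := b)); rewrite ?b_a // ltW.
by move: yj; rewrite (dist_eqr hK (y := b)) ?(cd_bx cd) // ltNge r_le_rad.
Qed.

Lemma far_outside s k : rad < abs (s - a) -> pint (ctr k) (en k) s = 0.
Proof.
move=> sa; apply: (pole_integral_large hK hp); first exact: en_ctr.
rewrite /en /ctr; case: (unliftP ord0 k) => [i|] ->; rewrite ?with_outerS ?with_outer0.
  rewrite b_x_self; apply: (@le_lt_trans _ _ rad); first exact: r_le_rad.
  rewrite (dist_eql hK (y := a)) // (absB hK); exact: le_lt_trans (x_a i) sa.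
by rewrite b_a.
Qed.

Lemma small_pint_hole (i j : 'I_M) s : (m <= i)%N -> abs (s - x j) < r j ->
  pint (x i) (b_ i) s = (i == j)%:R.
Proof.
move=> mi sj; have [ij|ij] := eqVneq i j.
  by rewrite /pint (pole_integral_small hK hp) // b_x_self ij.
rewrite /pint (pole_integral_large hK hp) //.
  by rewrite -subr_eq0 -(abs_gt0 hK) b_x_self (cd_r_gt0 cd).
by rewrite b_x_self; exact: small_hole_sep ij sj.
Qed.

(** * Points of the disc around [xbar] *)

Section Near.
Variable z : K.
Hypothesis zD : open_disc abs xbar rstar z.

Lemma z_xbar : abs (z - xbar) < rstar. Proof. exact: zD. Qed.

Lemma z_x i : abs (z - x i) = abs (xbar - x i).
Proof. by apply: (dist_eqr hK); apply: lt_le_trans z_xbar _; exact: (cd_rstar_le cd). Qed.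

Lemma z_xbar_rad : abs (z - xbar) < rad.
Proof. exact: lt_le_trans z_xbar rstar_le_rad. Qed.

Lemma near_in_region : D z.
Proof.
have [xa xh] := cd_xbar_in cd; split=> [|[j _] /= zj].
  by apply: (dist_le hK (y := xbar)) => //; apply/ltW/z_xbar_rad.
by apply: xh; exists j => //=; rewrite /open_disc /= -z_x.
Qed.

Lemma small_pint_near (i : 'I_M) : (m <= i)%N -> pint (x i) (b_ i) z = 0.
Proof.
move=> mi; apply: (pole_integral_large hK hp).
  by rewrite -subr_eq0 -(abs_gt0 hK) b_x_self (cd_r_gt0 cd).
by rewrite b_x_self z_x; exact: (cd_xbar_far cd).
Qed.

(** The endpoint of a large arc is at distance [rad] from [xbar], so the arc avoids the residue disc
    of [z]. A small arc stays on the circle of its hole, and [z] is strictly farther from the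
    centre. *)
Lemma arc_far_near k y : in_arc abs (ctr k) (en k) y -> abs (en k - ctr k) <= abs (y - z).
Proof.
have key e : abs (xbar - e) = rad -> abs (y - e) < rad -> rad <= abs (y - z).
  move=> xe ye; have ez : abs (e - z) = rad.
    by rewrite (absB hK) (dist_eqr hK (y := xbar)) xe // z_xbar_rad.
  by rewrite (dist_eqr hK (y := e)) ez.
rewrite /in_arc /en /ctr; case: (unliftP ord0 k) => [i|] ->; rewrite ?with_outerS ?with_outer0.
  rewrite b_x_self; have [im|im] := ltnP i m => yi.
    by move: yi; rewrite (cd_r_big cd im); apply: key; exact: (cd_xbar_b_ cd).
  have yx := small_arc_self yi; have rx := cd_xbar_far cd im.
  by rewrite (dist_eqr hK (y := x i)) (absB hK (x i)) z_x ?yx // ltW.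
by rewrite b_a; apply: key; exact: (cd_xbar_b cd).
Qed.

End Near.

Lemma region_bounded : exists C, forall y, D y -> abs y <= C.
Proof.
exists (Num.max rad (abs a)) => y [ya _]; rewrite -[y](subrK a).
by apply: (absD_le hK); rewrite le_max ?lexx ?orbT // [_ <= rad]ya.
Qed.

Lemma region_compl s : ~ D s -> rad < abs (s - a) \/ exists j, abs (s - x j) < r j.
Proof.
move=> Ds; have [sa|] := leP (abs (s - a)) rad; last by left.
right; apply: contrapT => h; apply: Ds; split=> // -[j _ sj]; apply: h.
by exists j.
Qed.

Lemma region_sep s : ~ D s -> exists2 d, 0 < d & forall y, D y -> d <= abs (y - s).
Proof.
case/region_compl => [sa|[j sj]].
  exists rad => // y [/= ya _]; rewrite (absB hK) (dist_eql hK (y := a)) ?ltW //.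
  by rewrite (absB hK); exact: le_lt_trans ya sa.
exists (r j); first exact: (cd_r_gt0 cd).
move=> y [_ yh]; have yj : r j <= abs (y - x j).
  by rewrite leNgt; apply/negP => yj; apply: yh; exists j.
rewrite (dist_eql hK (y := x j)) // (absB hK); exact: lt_le_trans sj yj.
Qed.

(** Testing at [xbar] and at the centres of the holes suffices, since the integrals do not change
    when the pole moves inside the disc around [xbar] or inside a hole. *)
Definition pole_system (v : 'I_M.+1 -> K) : Prop := forall k,
  \sum_i v i * pint (ctr i) (en i) (with_outer xbar x k) = (k == ord0)%:R.

Lemma big_en_ctr k : k \in big_arc -> abs (en k - ctr k) = rad.
Proof.
rewrite /en /ctr; case: (unliftP ord0 k) => [i|] ->; rewrite ?with_outerS ?with_outer0.
  by rewrite big_arcS => im; rewrite b_x_self (cd_r_big cd).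
by rewrite b_a.
Qed.

Lemma big_en_pt k l : k \in big_arc -> abs (en k - with_outer xbar x l) = rad.
Proof.
rewrite /en; case: (unliftP ord0 k) => [i|] ->; case: (unliftP ord0 l) => [j|] ->;
  rewrite ?with_outerS ?with_outer0 ?big_arcS => im.
- exact: (cd_b_x cd).
- by rewrite (absB hK) (cd_xbar_b_ cd).
- exact: (cd_bx cd).
- by rewrite (absB hK) (cd_xbar_b cd).
Qed.

Lemma big_pt_ctr k l : k \in big_arc -> abs (with_outer xbar x l - ctr k) <= rad.
Proof.
move=> kA; apply: (dist_le hK (y := en k)); last by rewrite big_en_ctr.
by rewrite (absB hK) big_en_pt.
Qed.

(** Amounts to [0 < rstar]: a centre of a hole is outside the region, so [xbar] is none of them. *)
Lemma xbar_near : open_disc abs xbar rstar xbar.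
Proof.
rewrite /open_disc /= subrr (abs0 hK); have [i ->] := cd_rstar_ex cd.
have [im|im] := ltnP i m; last exact: le_lt_trans (ltW (cd_r_gt0 cd i)) (cd_xbar_far cd im).
rewrite (abs_gt0 hK) subr_eq0; apply/eqP => xx; have [_] := cd_xbar_in cd; apply.
by exists i => //; rewrite /open_disc /= xx hole_center.
Qed.

Lemma small_pint k l : k \notin big_arc ->
  pint (ctr k) (en k) (with_outer xbar x l) = (k == l)%:R.
Proof.
rewrite /en /ctr; case: (unliftP ord0 k) => [i|] -> //; rewrite ?with_outerS big_arcS -leqNgt => mi.
case: (unliftP ord0 l) => [j|] ->; rewrite ?with_outerS ?with_outer0.
  by rewrite (small_pint_hole mi (hole_center j)) (inj_eq lift_inj).
by rewrite (small_pint_near xbar_near).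
Qed.

Lemma pole_system_ex : exists v, pole_system v.
Proof.
apply: (system_solvable hK hp hodd (A := big_arc) ord0 rad0).
- exact: big_en_ctr.
- by move=> k l kA _; exact: big_en_pt.
- move=> k l; rewrite /en; case: (unliftP ord0 k) => [i|] ->; case: (unliftP ord0 l) => [j|] ->;
    rewrite ?with_outerS ?with_outer0 ?big_arcS ?(inj_eq lift_inj) ?eqxx // => im jm ij.
  + exact: (cd_b_b_ cd).
  + by rewrite (absB hK) (cd_bb_ cd).
  + exact: (cd_bb_ cd).
- have xx (i : 'I_M) : (i < m)%N -> abs (xbar - x i) = rad.
    move=> im; apply/le_anti; rewrite xbar_x_le /= -(cd_r_big cd im) leNgt.
    by apply/negP => h; have [_] := cd_xbar_in cd; apply; exists i.
  move=> k l; case: (unliftP ord0 k) => [i|] ->; case: (unliftP ord0 l) => [j|] ->;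
    rewrite ?with_outerS ?with_outer0 ?big_arcS ?(inj_eq lift_inj) ?eqxx // => im jm ij.
  + by rewrite x_x_big // im.
  + by rewrite (absB hK) xx.
  + by rewrite xx.
- exact: small_pint.
Qed.

Lemma pole_system_near v z : pole_system v -> open_disc abs xbar rstar z ->
  \sum_i v i * pint (ctr i) (en i) z = 1.
Proof.
move=> hv zD; rewrite -[RHS](hv ord0) with_outer0; apply: eq_bigr => k _; congr (_ * _).
have [kA|kA] := boolP (k \in big_arc).
  have := big_pt_ctr ord0 kA; have := big_en_pt ord0 kA; rewrite with_outer0 => h1 h2.
  apply/esym/(pole_integral_eq hK hp hodd alpha rad0 (big_en_ctr kA) h2).
  - by rewrite (absB hK) h1.
  - by rewrite subrr (abs0 hK).
  - by rewrite subrr (abs0 hK).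
  - by rewrite (absB hK) z_xbar_rad.
have := small_pint ord0 kA; rewrite with_outer0 => ->.
move: kA; rewrite /en /ctr; case: (unliftP ord0 k) => [i|] -> //.
by rewrite !with_outerS big_arcS -leqNgt => mi; rewrite small_pint_near.
Qed.

Lemma pole_system_outside v s : pole_system v -> ~ D s ->
  \sum_i v i * pint (ctr i) (en i) s = 0.
Proof.
move=> hv /region_compl [sa|[j sj]].
  by rewrite big1 // => k _; rewrite far_outside ?mulr0.
have := hv (lift ord0 j); rewrite with_outerS => e; rewrite -[RHS]e.
apply: eq_bigr => k _; congr (_ * _).
have [kA|kA] := boolP (k \in big_arc).
  have := big_pt_ctr (lift ord0 j) kA; have := big_en_pt (lift ord0 j) kA; rewrite with_outerS => h1 h2.
  apply/esym/(pole_integral_eq hK hp hodd alpha rad0 (big_en_ctr kA) h2).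
  - by rewrite (absB hK) h1.
  - by rewrite subrr (abs0 hK).
  - by rewrite subrr (abs0 hK).
  - by rewrite (absB hK); apply: lt_le_trans sj _; exact: r_le_rad.
have := small_pint (lift ord0 j) kA; rewrite with_outerS => ->.
move: kA; rewrite /en /ctr; case: (unliftP ord0 k) => [i|] -> //.
rewrite !with_outerS big_arcS -leqNgt => mi.
by rewrite (small_pint_hole mi sj) (inj_eq lift_inj).
Qed.

End Geometry.
(** Neither centre lies on the common circle, whereas a distance [abs (a - a')] above [rad] would
    put [a] on it, and a distance equal to [rad] would put [a'] on it. *)
Lemma circle_center a rad b a' rad' : 0 < rad -> 0 < rad' -> circle abs a rad b ->
  circle abs a rad = circle abs a' rad' -> abs (a - a') < rad.
Proof.
move=> r0 r0' ba e.
have ba' : abs (b - a') = rad' by have : circle abs a' rad' b by rewrite -e.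
have na : ~ circle abs a' rad' a.
  by rewrite -e /circle /= subrr (abs0 hK) => h; rewrite -h ltxx in r0.
have na' : ~ circle abs a rad a'.
  by rewrite e /circle /= subrr (abs0 hK) => h; rewrite -h ltxx in r0'.
have [//|lt|eq] := ltgtP (abs (a - a')) rad.
  case: na; rewrite /circle /= -ba' (dist_eqr hK (y := a)) //.
  by rewrite (ba : abs (b - a) = rad).
by case: na'; rewrite /circle /= (absB hK).
Qed.

Definition contour_of (a : K) (rad : R) (x : 'I_M -> K) (r : 'I_M -> R) (b : K)
    (b_ : 'I_M -> K) : contour K M :=
  Contour (region abs a rad x r) (fun i => open_disc abs (x i) (r i)) (circle abs a rad)
    (padic_arc abs a b) (fun i => padic_arc abs (x i) (b_ i)).

Lemma padic_arc_in a b : b != a -> padic_arc abs a b b.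
Proof.
by move=> ba; rewrite /padic_arc /open_disc /= subrr (abs0 hK) (abs_gt0 hK) subr_eq0 eq_sym.
Qed.

(** Equal sets place corresponding points in the same residue discs, so the entries of large arcs
    agree by rigidity; for a small arc both entries are the same Kronecker symbol. *)
Lemma pole_system_transfer a rad x r b b_ xbar rstar a' rad' x' r' b' b_' xbar' rstar' v :
  contour_data abs m a rad x r b b_ xbar rstar ->
  contour_data abs m a' rad' x' r' b' b_' xbar' rstar' ->
  open_disc abs xbar rstar = open_disc abs xbar' rstar' ->
  contour_of a rad x r b b_ = contour_of a' rad' x' r' b' b_' ->
  pole_system a x b b_ xbar v -> pole_system a' x' b' b_' xbar' v.
Proof.
move=> cd cd' eD [_ eH eC eA eA_] hv k; rewrite -(hv k); apply: eq_bigr => i _.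
congr (_ * _); apply/esym; have rad0 := cd_rad_gt0 cd.
have aa : abs (a - a') < rad.
  exact: circle_center rad0 (cd_rad_gt0 cd') (cd_b_circle cd) eC.
have xx j : abs (x j - x' j) < r j.
  rewrite (absB hK); suff : open_disc abs (x j) (r j) (x' j) by [].
  by rewrite (congr1 (fun H => H j) eH) /open_disc /= (hole_center cd').
have bb : abs (b - b') < rad.
  rewrite (absB hK) -(b_a cd) (absB hK b); suff : padic_arc abs a b b' by [].
  by rewrite eA; apply: padic_arc_in; have := en_ctr cd' ord0; rewrite !with_outer0.
have bb_ j : abs (b_ j - b_' j) < r j.
  rewrite (absB hK) -(b_x_self cd) (absB hK (b_ j) (x j)).
  suff : padic_arc abs (x j) (b_ j) (b_' j) by [].
  rewrite (congr1 (fun H => H j) eA_); apply: padic_arc_in.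
  by have := en_ctr cd' (lift ord0 j); rewrite !with_outerS.
have xbx : abs (xbar - xbar') < rad.
  rewrite (absB hK); apply: lt_le_trans (rstar_le_rad cd).
  suff : open_disc abs xbar rstar xbar' by [].
  by rewrite eD; exact: xbar_near cd'.
have near (T1 T2 : K) (F1 F2 : 'I_M -> K) l : abs (T1 - T2) < rad ->
    (forall j, abs (F1 j - F2 j) < r j) ->
    abs (with_outer T1 F1 l - with_outer T2 F2 l) < rad.
  move=> hT hF; case: (unliftP ord0 l) => [j|] ->; rewrite ?with_outerS ?with_outer0 //.
  exact: lt_le_trans (hF j) (r_le_rad cd j).
have [im|im] := leqP i m.
  apply: (pole_integral_eq hK hp hodd alpha rad0 (big_en_ctr cd im)).
  - exact: big_pt_ctr cd _ _ im.
  - by rewrite (absB hK) (big_en_pt cd).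
  - exact: near.
  - exact: near.
  - exact: near.
have im' : ~~ (i <= m)%N by rewrite -ltnNge.
by rewrite (small_pint cd _ im') (small_pint cd' _ im').
Qed.

Lemma contour_formula a rad x r b b_ xbar rstar v z f :
  contour_data abs m a rad x r b b_ xbar rstar -> pole_system a x b b_ xbar v ->
  open_disc abs xbar rstar z -> krasner_analytic abs (region abs a rad x r) f ->
  exists (I0 : K) (I : 'I_M -> K),
    [/\ arc_integral abs p a b (Phi_ alpha%:Z) (fun y => f y / (y - z)) I0,
        forall i : 'I_M, arc_integral abs p (x i) (b_ i) (Phi_ alpha%:Z)
                   (fun y => f y / (y - z)) (I i)
      & f z = v ord0 * I0 + \sum_(i < M) v (lift ord0 i) * I i].
Proof.
move=> cd hv zD hf.
have [I [cI eI]] := formula_krasner hK hp hodd (en_ctr cd) (arc_in_region cd)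
  (arc_far_near cd zD) (near_in_region cd zD) (region_bounded a rad x r) (region_sep cd)
  (pole_system_near cd hv zD) (fun s => pole_system_outside cd hv (s := s)) hf.
exists (I ord0), (fun i => I (lift ord0 i)); split.
- by have := conv_arc_integral (cI ord0); rewrite !with_outer0.
- by move=> i; have := conv_arc_integral (cI (lift ord0 i)); rewrite !with_outerS.
- by rewrite eI big_ord_recl.
Qed.
End Contour.

(** * Selection of the constants from set-level data *)

Theorem theorem6p11 (R : realType) (p : nat) (hp : prime p) (hp_odd : odd p)
    (K : closedFieldType) (abs : K -> R) (hK : is_Cp abs p)
    (M m : nat) (hm : (0 < m <= M)%N) (alpha : nat) :
  exists mu : set K -> contour K M -> 'I_M.+1 -> K,
  forall (a : K) (rad : R) (x : 'I_M -> K) (r : 'I_M -> R)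
         (b : K) (b_ : 'I_M -> K) (xbar : K) (rstar : R),
    0 < rad ->
    (forall i, 0 < r i) ->
    (forall i : 'I_M, (i < m)%N -> r i = rad) ->
    (forall i : 'I_M, (m <= i)%N -> r i < rad) ->
    (forall i : 'I_M, (i < m)%N -> abs (a - x i) = rad) ->
    trivIset setT (fun i => open_disc abs (x i) (r i)) ->
    trivIset [set i : 'I_M | (m <= i)%N]
      (fun i => closed_disc abs (x i) (r i)) ->
    circle abs a rad b ->
    (forall i, abs (b - x i) = rad) ->
    (forall i, circle abs (x i) (r i) (b_ i)) ->
    (forall i j : 'I_M, (i < m)%N -> abs (b_ i - x j) = rad) ->
    (forall i j : 'I_M, (i < m)%N -> i != j -> abs (b_ i - b_ j) = rad) ->
    (forall i : 'I_M, (i < m)%N -> abs (b - b_ i) = rad) ->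
    region abs a rad x r xbar ->
    abs (xbar - b) = rad ->
    (forall i : 'I_M, (i < m)%N -> abs (xbar - b_ i) = rad) ->
    (forall i : 'I_M, (m <= i)%N -> r i < abs (xbar - x i)) ->
    (exists i, rstar = abs (xbar - x i)) ->
    (forall i, rstar <= abs (xbar - x i)) ->
    let D := region abs a rad x r in
    let Dstar := open_disc abs xbar rstar in
    let c := mu Dstar
      (Contour D (fun i => open_disc abs (x i) (r i)) (circle abs a rad)
               (padic_arc abs a b) (fun i => padic_arc abs (x i) (b_ i))) in
    forall (z : K) (f : K -> K), Dstar z -> krasner_analytic abs D f ->
    exists (I0 : K) (I : 'I_M -> K),
      [/\ arc_integral abs p a b (Phi_ alpha%:Z) (fun y => f y / (y - z)) I0,
          forall i : 'I_M, arc_integral abs p (x i) (b_ i) (Phi_ alpha%:Z)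
                     (fun y => f y / (y - z)) (I i)
        & f z = c ord0 * I0 + \sum_(i < M) c (lift ord0 i) * I i].
Proof.
(* The weights are chosen from the sets alone, before any centre or endpoint is named: one
   presentation provides them, and the transfer makes them valid for all presentations of the same
   sets. *)
have sel (c : set K * contour K M) : exists v : 'I_M.+1 -> K,
    forall a rad x r b b_ xbar rstar, contour_data abs m a rad x r b b_ xbar rstar ->
      c = (open_disc abs xbar rstar, contour_of abs a rad x r b b_) ->
      pole_system abs p alpha a x b b_ xbar v.
  have [[a [rad [x [r [b [b_ [xbar [rstar [cd ec]]]]]]]]]|none] := pselect
    (exists a rad x r b b_ xbar rstar, contour_data abs m a rad x r b b_ xbar rstar /\
      c = (open_disc abs xbar rstar, contour_of abs a rad x r b b_)); last first.
    (* Data that arise from no contour receive the value 0. *)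
    exists (fun=> 0) => a rad x r b b_ xbar rstar cd ec; case: none.
    by exists a, rad, x, r, b, b_, xbar, rstar.
  have [v hv] := pole_system_ex hK hp hp_odd alpha cd.
  exists v => a' rad' x' r' b' b_' xbar' rstar' cd'; rewrite ec => -[eD eR eH eC eA eA_].
  apply: (pole_system_transfer hK hp hp_odd cd cd' eD _ hv).
  by rewrite /contour_of eR eH eC eA eA_.
have [mu hmu] := choice sel.
exists (fun D c => mu (D, c)) => a rad x r b b_ xbar rstar.
move=> h1 h2 h3 h4 _ h6 h7 h8 h9 h10 h11 h12 h13 h14 h15 h16 h17 h18 h19.
have cd : contour_data abs m a rad x r b b_ xbar rstar by split.
move=> D Dstar c z f zD hf.
apply: (contour_formula hK hp hp_odd cd (v := c) _ zD hf).
exact: hmu cd erefl.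
Qed.
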